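(* Let $G$ be a finite group of order $n$, let $\xi\in\mathbb{C}$ be a primitive $n$-th root of unity, let $\overline{R}(G)=R(G)\otimes_{\mathbb{Z}}\mathbb{Z}[\xi]$ and $C=\operatorname{Spec}(\overline{R}(G))$. Let $P=\overline{Q}^{(c)}\in C$ be a point, with $Q\in\operatorname{Spec}(\mathbb{Z}[\xi])$ and $c\in\mathsf{Cl}(G)$. Set $p:=\operatorname{char}(\mathbb{Z}[\xi]/Q)$, i.e. $(p)$ is the image of $P$ under the morphism $C\to\operatorname{Spec}(\mathbb{Z})$. (I) The following are equivalent: (i) $P$ is singular; (ii) $P$ belongs to two distinct irreducible components of $C$; (iii) $Q\neq 0$ and there is a class $d\in\mathsf{Cl}(G)\setminus\{c\}$ such that $c^{(p)}_r=d^{(p)}_r$. (II) If $p\nmid |G|$, then $P$ is non-singular.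
   Context: $\mathsf{Cl}(G)$ is the set of conjugacy classes of $G$. The representation ring $R(G)$ is the ring of $\mathbb{Z}$-linear combinations of the irreducible complex characters of $G$, with pointwise product. The ring $\overline{R}(G)$ is identified with the ring of $\mathbb{Z}[\xi]$-linear combinations of irreducible characters, a subring of the ring $\mathbb{Z}[\xi]^{\mathsf{Cl}(G)}$ of functions $\mathsf{Cl}(G)\to\mathbb{Z}[\xi]$. For $Q\in\operatorname{Spec}(\mathbb{Z}[\xi])$ and $c\in\mathsf{Cl}(G)$, put $\overline{Q}^{(c)}:=\{\chi\in\overline{R}(G)\mid\chi(c)\in Q\}$; these are prime ideals of $\overline{R}(G)$, and every point of $C$ is of this form. For a prime $p$, each $g\in G$ is uniquely written $g=g_u^{(p)}g_r^{(p)}$ with $g_u^{(p)},g_r^{(p)}\in\langle g\rangle$, where $g_u^{(p)}$ has $p$-power order and the order of $g_r^{(p)}$ is not divisible by $p$. For a conjugacy class $c$, $c_r^{(p)}:=\{g_r^{(p)}\mid g\in c\}$, which is again a conjugacy class. A point $P$ of a scheme $X$, with local ring $\mathcal{O}_P$, maximal ideal $\mathfrak{m}_P$ and residue field $k_P$, is regular (nonsingular, smooth) if $\mathcal{O}_P$ is regular, i.e. $\dim_{k_P}(\mathfrak{m}_P/\mathfrak{m}_P^2)=\dim(\mathcal{O}_P)$ (Krull dimension); otherwise it is singular. *)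

(* Defs.v *)
From HB Require Import structures.
From mathcomp Require Import all_boot all_order all_algebra all_fingroup.
From mathcomp Require Import all_solvable all_field all_character.
From mathcomp Require Import generic_quotient ring_quotient.
From mathcomp Require Import boolp classical_sets topology_structure.
From mathcomp Require Import ring.

Set Implicit Arguments.
Unset Strict Implicit.
Unset Printing Implicit Defensive.
Import GRing.Theory Num.Theory.

Local Open Scope ring_scope.

(* Membership is boolean, as in the library's [prime_idealr]; this is no
   restriction since we reason classically.  The bundled type [prime_idealr A]
   itself lives in too large a universe to carry sets and a topology. *)
Record spec (A : comNzRingType) := Spec {
  spec_pred :> A -> bool;
  spec_idealr : idealr_closed spec_pred;
  spec_prime : prime_idealr_closed spec_pred
}.

HB.instance Definition _ (A : comNzRingType) (P : spec A) :=
  isIdealr.Build A (spec_pred P) (spec_idealr P).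
HB.instance Definition _ (A : comNzRingType) (P : spec A) :=
  isPrimeIdealrClosed.Build A (spec_pred P) (@spec_prime A P).

HB.instance Definition _ (A : comNzRingType) := gen_eqMixin (spec A).
HB.instance Definition _ (A : comNzRingType) := gen_choiceMixin (spec A).

Section Zariski.
Variable A : comNzRingType.
Local Open Scope classical_set_scope.

Definition zariski_V (E : set A) : set (spec A) :=
  [set P : spec A | forall f, E f -> f \in (P : pred A)].

Definition zariski_open (U : set (spec A)) : Prop :=
  exists E : set A, U = ~` zariski_V E.

Lemma zariski_openT : zariski_open setT.
Proof.
exists [set 1]; apply/seteqP; split => [P _ /(_ 1 erefl)|//].
by rewrite (idealr1 P).
Qed.

Lemma zariski_openI : setI_closed zariski_open.
Proof.
move=> _ _ [E ->] [F ->].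
exists [set h | exists f g, [/\ E f, F g & h = f * g]].
rewrite -setCU; congr (~` _); apply/seteqP; split => P.
  case=> PV _ [f [g [Ef Fg ->]]]; rewrite (prime_idealrM P).
    by rewrite (PV f Ef).
  by rewrite (PV g Fg) orbT.
move=> PV; have [PE|/existsNP[f /not_implyP[Ef Pf]]] :=
  pselect (forall f, E f -> f \in (P : pred A)); [by left | right => g Fg].
have := PV (f * g); rewrite (prime_idealrM P) (negPf (introN idP Pf)) /=.
by apply; exists f, g.
Qed.

Lemma zariski_open_bigU (I : Type) (U : I -> set (spec A)) :
  (forall i, zariski_open (U i)) -> zariski_open (\bigcup_i U i).
Proof.
move=> /choice[E EU].
exists [set f | exists i, E i f]; apply/seteqP; split => P.
  case=> i _; rewrite EU => PE PV; apply: PE => f Ef.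
  by apply: PV; exists i.
move=> PV; apply: contrapT => nP; apply: PV => f [i Eif].
apply: contrapT => Pf; apply: nP; exists i => //; rewrite EU => PV.
exact/Pf/PV.
Qed.

HB.instance Definition _ := @isOpenTopological.Build (spec A)
  zariski_open zariski_openT zariski_openI zariski_open_bigU.

End Zariski.

Section Irreducible.
Variable T : topologicalType.
Local Open Scope classical_set_scope.

Definition irreducible (Z : set T) : Prop :=
  Z !=set0 /\ forall F1 F2 : set T, closed F1 -> closed F2 ->
    Z `<=` F1 `|` F2 -> Z `<=` F1 \/ Z `<=` F2.

(* Maximal irreducible subsets; these are automatically closed. *)
Definition irreducible_component (Z : set T) : Prop :=
  irreducible Z /\ forall Y, irreducible Y -> Z `<=` Y -> Y = Z.

End Irreducible.

Section SpecMap.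
Variables (A B : comNzRingType) (f : {rmorphism A -> B}) (Q : spec B).

Definition preim_pred : A -> bool := fun x => f x \in (Q : pred B).

Lemma preim_predE x : (x \in preim_pred) = (f x \in (Q : pred B)).
Proof. by []. Qed.

Lemma preim_idealr_closed : idealr_closed preim_pred.
Proof.
split; rewrite ?preim_predE ?rmorph0 ?rmorph1 ?idealr0 ?idealr1 //.
move=> a x y; rewrite !preim_predE => xQ yQ.
by rewrite rmorphD rmorphM rpredD // (idealMr _ xQ).
Qed.

Lemma preim_prime_idealr_closed : prime_idealr_closed preim_pred.
Proof. by move=> x y; rewrite !preim_predE rmorphM prime_idealrM. Qed.

Definition spec_map : spec A :=
  Spec preim_idealr_closed preim_prime_idealr_closed.

End SpecMap.

(* The kernel of the canonical map from the integers to R is generated by p;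
   p = 0 is allowed since 0 divides only 0. *)
Definition has_char (R : nzRingType) (p : nat) : Prop :=
  forall m : nat, (m%:R == 0 :> R) = (p %| m)%N.

Definition prime_chain (A : comNzRingType) (d : nat) : Prop :=
  exists P : 'I_d.+1 -> spec A, forall i j : 'I_d.+1, (i < j)%N ->
    {subset (P i : pred A) <= (P j : pred A)} /\
    ~ {subset (P j : pred A) <= (P i : pred A)}.

Definition has_krull_dim (A : comNzRingType) (d : nat) : Prop :=
  prime_chain A d /\ forall e, prime_chain A e -> (e <= d)%N.

(* V is isomorphic to K^d. *)
Definition has_dim (K : nzRingType) (V : lmodType K) (d : nat) : Prop :=
  inhabited (Vector.axiom d V).

Section Localization.
Variables (A : comNzRingType) (P : spec A).
Local Open Scope quotient_scope.

Record denom := Denom { den : A; denP : den \notin (P : pred A) }.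

HB.instance Definition _ := [isSub for den].
HB.instance Definition _ := [Choice of denom by <:].

Lemma denom1_subproof : 1 \notin (P : pred A).
Proof. by rewrite (idealr1 P). Qed.

Lemma denomM_subproof (s t : denom) : den s * den t \notin (P : pred A).
Proof. by rewrite (prime_idealrM P) negb_or (denP s) (denP t). Qed.

Definition denom1 := Denom denom1_subproof.
Definition denomM s t := Denom (denomM_subproof s t).

Lemma den_denomM s t : den (denomM s t) = den s * den t. Proof. by []. Qed.
Lemma den_denom1 : den denom1 = 1. Proof. by []. Qed.
Let denE := (den_denomM, den_denom1).

Definition loc_rel (x y : A * denom) : bool :=
  `[< exists t : denom, den t * (x.1 * den y.2) = den t * (y.1 * den x.2) >].

Lemma loc_rel_refl : reflexive loc_rel.
Proof. by move=> x; apply/asboolP; exists denom1. Qed.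

Lemma loc_rel_sym : symmetric loc_rel.
Proof. by move=> x y; apply/asboolP/asboolP => -[t e]; exists t. Qed.

Lemma loc_rel_trans : transitive loc_rel.
Proof.
move=> y x z /asboolP[t e] /asboolP[u f]; apply/asboolP.
exists (denomM y.2 (denomM t u)); rewrite !denE.
transitivity (den z.2 * den u * (den t * (x.1 * den y.2))); first by ring.
rewrite e.
transitivity (den x.2 * den t * (den u * (y.1 * den z.2))); first by ring.
by rewrite f; ring.
Qed.

Canonical loc_equiv := EquivRel loc_rel loc_rel_refl loc_rel_sym loc_rel_trans.

Definition localization := {eq_quot loc_rel}.

HB.instance Definition _ : EqQuotient _ loc_rel localization :=
  EqQuotient.on localization.
HB.instance Definition _ := Choice.on localization.

Definition loc_frac (a : A) (s : denom) : localization :=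
  \pi_localization (a, s).

Lemma loc_fracP a s b t :
  loc_frac a s = loc_frac b t <->
  exists u : denom, den u * (a * den t) = den u * (b * den s).
Proof.
split=> [/eqmodP/asboolP //|h]; exact/eqmodP/asboolP.
Qed.

Lemma loc_fracE (x : localization) : x = loc_frac (repr x).1 (repr x).2.
Proof. by rewrite /loc_frac -surjective_pairing reprK. Qed.

Lemma loc_repr a s : exists u : denom,
  den u * (a * den (repr (loc_frac a s)).2) =
  den u * ((repr (loc_frac a s)).1 * den s).
Proof. exact/loc_fracP/loc_fracE. Qed.

Definition loc_add (x y : localization) : localization :=
  loc_frac ((repr x).1 * den (repr y).2 + (repr y).1 * den (repr x).2)
           (denomM (repr x).2 (repr y).2).
Definition loc_mul (x y : localization) : localization :=
  loc_frac ((repr x).1 * (repr y).1) (denomM (repr x).2 (repr y).2).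
Definition loc_opp (x : localization) : localization :=
  loc_frac (- (repr x).1) (repr x).2.

Lemma loc_addE a s b t : loc_add (loc_frac a s) (loc_frac b t) =
  loc_frac (a * den t + b * den s) (denomM s t).
Proof.
have [u eu] := loc_repr a s; have [v ev] := loc_repr b t.
apply/loc_fracP; exists (denomM u v); rewrite !denE; move: eu ev.
case: (repr _) => a' s'; case: (repr _) => b' t' /= eu ev.
transitivity (den v * den t' * den t * (den u * (a' * den s))
  + den u * den s' * den s * (den v * (b' * den t))); first by ring.
by rewrite -eu -ev; ring.
Qed.

Lemma loc_mulE a s b t : loc_mul (loc_frac a s) (loc_frac b t) =
  loc_frac (a * b) (denomM s t).
Proof.
have [u eu] := loc_repr a s; have [v ev] := loc_repr b t.
apply/loc_fracP; exists (denomM u v); rewrite !denE; move: eu ev.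
case: (repr _) => a' s'; case: (repr _) => b' t' /= eu ev.
transitivity ((den u * (a' * den s)) * (den v * (b' * den t))); first by ring.
by rewrite -eu -ev; ring.
Qed.

Lemma loc_oppE a s : loc_opp (loc_frac a s) = loc_frac (- a) s.
Proof.
have [u eu] := loc_repr a s; apply/loc_fracP; exists u; move: eu.
case: (repr _) => a' s' /= eu.
transitivity (- (den u * (a' * den s))); first by ring.
by rewrite -eu; ring.
Qed.

Lemma loc_ind (T : localization -> Prop) :
  (forall a s, T (loc_frac a s)) -> forall x, T x.
Proof. by move=> h x; rewrite (loc_fracE x). Qed.

Lemma loc_addA : associative loc_add.
Proof.
elim/loc_ind=> a s; elim/loc_ind=> b t; elim/loc_ind=> c u.
by rewrite !loc_addE; apply/loc_fracP; exists denom1; rewrite !denE /=; ring.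
Qed.

Lemma loc_addC : commutative loc_add.
Proof.
elim/loc_ind=> a s; elim/loc_ind=> b t.
by rewrite !loc_addE; apply/loc_fracP; exists denom1; rewrite !denE /=; ring.
Qed.

Lemma loc_add0 : left_id (loc_frac 0 denom1) loc_add.
Proof.
elim/loc_ind=> a s.
by rewrite !loc_addE; apply/loc_fracP; exists denom1; rewrite !denE /=; ring.
Qed.

Lemma loc_addN : left_inverse (loc_frac 0 denom1) loc_opp loc_add.
Proof.
elim/loc_ind=> a s.
by rewrite loc_oppE !loc_addE; apply/loc_fracP; exists denom1; rewrite !denE /=; ring.
Qed.

HB.instance Definition _ := GRing.isZmodule.Build localization
  loc_addA loc_addC loc_add0 loc_addN.

Lemma loc_mulA : associative loc_mul.
Proof.
elim/loc_ind=> a s; elim/loc_ind=> b t; elim/loc_ind=> c u.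
by rewrite !loc_mulE; apply/loc_fracP; exists denom1; rewrite !denE /=; ring.
Qed.

Lemma loc_mulC : commutative loc_mul.
Proof.
elim/loc_ind=> a s; elim/loc_ind=> b t.
by rewrite !loc_mulE; apply/loc_fracP; exists denom1; rewrite !denE /=; ring.
Qed.

Lemma loc_mul1 : left_id (loc_frac 1 denom1) loc_mul.
Proof.
elim/loc_ind=> a s.
by rewrite !loc_mulE; apply/loc_fracP; exists denom1; rewrite !denE /=; ring.
Qed.

Lemma loc_mulDl : left_distributive loc_mul loc_add.
Proof.
elim/loc_ind=> a s; elim/loc_ind=> b t; elim/loc_ind=> c u.
rewrite loc_addE !loc_mulE loc_addE.
by apply/loc_fracP; exists denom1; rewrite !denE /=; ring.
Qed.

Lemma loc_1neq0 : loc_frac 1 denom1 != 0.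
Proof.
apply/eqP => /loc_fracP[u] /=; rewrite !mulr1 mulr0 => u0.
by have := denP u; rewrite u0 (idealr0 P).
Qed.

HB.instance Definition _ := GRing.Zmodule_isComNzRing.Build localization
  loc_mulA loc_mulC loc_mul1 loc_mulDl loc_1neq0.

Definition loc_max_pred : localization -> bool := fun x =>
  `[< exists (a : A) (s : denom), a \in (P : pred A) /\ x = loc_frac a s >].

Lemma loc_max_idealr_closed : idealr_closed loc_max_pred.
Proof.
split.
- by apply/asboolP; exists 0, denom1; rewrite (idealr0 P).
- apply/asboolP => -[a [s [aP /loc_fracP[u] /=]]].
  rewrite mul1r mulr1 => e.
  have : den u * den s \in (P : pred A).
    by rewrite e (idealMr).
  by rewrite (negPf (denomM_subproof u s)).
move=> x y z /asboolP[a [s [aP ->]]] /asboolP[b [t [bP ->]]].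
elim/loc_ind: x => c u; apply/asboolP.
exists (c * a * den t + b * den (denomM u s)), (denomM (denomM u s) t); split.
  apply: rpredD; last by rewrite mulrC (idealMr).
  by rewrite mulrAC (idealMr).
by rewrite -loc_addE -loc_mulE.
Qed.

HB.instance Definition _ :=
  isIdealr.Build localization loc_max_pred loc_max_idealr_closed.

Definition loc_max_ideal : idealr localization := loc_max_pred.

End Localization.

Section Cotangent.
Variables (A : comNzRingType) (m : idealr A).
Local Open Scope quotient_scope.
Local Notation K := {ideal_quot m}.

Record ideal_elt := IdealElt { ielt : A; ieltP : ielt \in (m : pred A) }.

HB.instance Definition _ := [isSub for ielt].
HB.instance Definition _ := [Choice of ideal_elt by <:].
HB.instance Definition _ := [SubChoice_isSubZmodule of ideal_elt by <:].

Lemma ieltB x y : ielt (x - y) = ielt x - ielt y.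
Proof. exact: (raddfB (val : ideal_elt -> A)). Qed.
Lemma ieltD x y : ielt (x + y) = ielt x + ielt y.
Proof. exact: (raddfD (val : ideal_elt -> A)). Qed.

(* The elements of m lying in the ideal m^2, i.e. finite sums of products. *)
Definition ideal_sq : {pred ideal_elt} := fun z =>
  `[< exists (k : nat) (x y : 'I_k -> ideal_elt),
        ielt z = \sum_i ielt (x i) * ielt (y i) >].

Lemma ideal_sq_zmod_closed : zmod_closed ideal_sq.
Proof.
split; first by apply/asboolP; exists 0, (fun=> 0), (fun=> 0); rewrite big_ord0.
move=> u v /asboolP[k [x [y e]]] /asboolP[l [z [t f]]]; apply/asboolP.
exists (k + l)%N, (fun i => match split i with inl j => x j | inr j => - z j end),
  (fun i => match split i with inl j => y j | inr j => t j end).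
rewrite ieltB e f big_split_ord -sumrN; congr (_ + _); apply: eq_bigr => i _.
  by rewrite (unsplitK (inl i)).
by rewrite (unsplitK (inr i)) mulNr.
Qed.

HB.instance Definition _ :=
  GRing.isZmodClosed.Build ideal_elt ideal_sq ideal_sq_zmod_closed.

(* The A/m-module m/m^2. *)
Definition cotangent := Quotient.quot (ideal_sq : zmodClosed ideal_elt).

HB.instance Definition _ := GRing.Zmodule.on cotangent.

Definition ideal_scale (a : A) (x : ideal_elt) : ideal_elt :=
  IdealElt (idealMr a (ieltP x)).

Definition cot_scale (a : K) (x : cotangent) : cotangent :=
  \pi_cotangent (ideal_scale (repr a) (repr x)).

Lemma ideal_sq_scale a x : x \in ideal_sq -> ideal_scale a x \in ideal_sq.
Proof.
move=> /asboolP[k [y [z e]]]; apply/asboolP.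
exists k, (fun i => ideal_scale a (y i)), z; rewrite /= e mulr_sumr.
by apply: eq_bigr => i _; rewrite mulrA.
Qed.

Lemma cot_eqP (x y : ideal_elt) :
  \pi_cotangent x = \pi_cotangent y <-> x - y \in ideal_sq.
Proof.
by split=> [/eqP|h]; [|apply/eqP]; rewrite -Quotient.idealrBE.
Qed.

Lemma cot_scaleE a x :
  cot_scale (\pi_K a) (\pi_cotangent x) = \pi_cotangent (ideal_scale a x).
Proof.
apply/cot_eqP.
have ha : repr (\pi_K a) - a \in (m : pred A).
  by rewrite Quotient.idealrBE reprK.
have hx : repr (\pi_cotangent x) - x \in ideal_sq by apply/cot_eqP; rewrite reprK.
set b := repr _ in ha *; set y := repr _ in hx *.
have -> : ideal_scale b y - ideal_scale a x =
    ideal_scale b (y - x) + ideal_scale (b - a) x.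
  by apply: val_inj => /=; ring.
apply: rpredD; first exact: ideal_sq_scale.
apply/asboolP; exists 1%N, (fun=> IdealElt ha), (fun=> x).
by rewrite big_ord1.
Qed.

Lemma cot_scaleA a b x : cot_scale a (cot_scale b x) = cot_scale (a * b) x.
Proof.
elim/quotW: a => a; elim/quotW: b => b; elim/quotW: x => x.
rewrite -rmorphM (cot_scaleE b x) (cot_scaleE a) cot_scaleE.
by apply: (congr1 \pi_cotangent); apply: val_inj; rewrite /= mulrA.
Qed.

Lemma cot_scale1 : left_id 1 cot_scale.
Proof.
elim/quotW=> x; rewrite -(rmorph1 \pi_K) cot_scaleE.
by apply: (congr1 \pi_cotangent); apply: val_inj; rewrite /= mul1r.
Qed.

Lemma cot_scaleDr : right_distributive cot_scale +%R.
Proof.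
elim/quotW=> a; elim/quotW=> x; elim/quotW=> y.
rewrite -(raddfD \pi_cotangent) (cot_scaleE a x) (cot_scaleE a y).
rewrite (cot_scaleE a (x + y)) -(raddfD \pi_cotangent).
by apply: (congr1 \pi_cotangent); apply: val_inj; rewrite /= mulrDr.
Qed.

Lemma cot_scaleDl x : {morph cot_scale^~ x : a b / a + b}.
Proof.
elim/quotW: x => x; elim/quotW=> a; elim/quotW=> b.
rewrite -(raddfD \pi_K) (cot_scaleE a) (cot_scaleE b) (cot_scaleE (a + b)).
rewrite -(raddfD \pi_cotangent).
by apply: (congr1 \pi_cotangent); apply: val_inj; rewrite /= mulrDl.
Qed.

HB.instance Definition _ := GRing.Zmodule_isLmodule.Build K cotangent
  cot_scaleA cot_scale1 cot_scaleDr cot_scaleDl.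

End Cotangent.

Definition regular_point (A : comNzRingType) (P : spec A) : Prop :=
  exists d : nat, has_krull_dim (localization P) d /\
    has_dim (cotangent (loc_max_ideal P)) d.

Definition singular_point (A : comNzRingType) (P : spec A) : Prop :=
  ~ regular_point P.

Definition in_two_components (T : topologicalType) (x : T) : Prop :=
  exists Z1 Z2 : set T, [/\ irreducible_component Z1, irreducible_component Z2,
    Z1 <> Z2, Z1 x & Z2 x].

Section AdjoinInt.
Variable xi : algC.

Definition adjoin_int : {pred algC} :=
  fun x => `[< exists p : {poly int}, x = (map_poly intr p).[xi] >].

Lemma adjoin_int_subring_closed : subring_closed adjoin_int.
Proof.
split.
- by apply/asboolP; exists 1; rewrite rmorph1 hornerE.
- move=> x y /asboolP[p ->] /asboolP[q ->]; apply/asboolP.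
  by exists (p - q); rewrite rmorphB !hornerE.
- move=> x y /asboolP[p ->] /asboolP[q ->]; apply/asboolP.
  by exists (p * q); rewrite rmorphM !hornerE.
Qed.

HB.instance Definition _ :=
  GRing.isSubringClosed.Build algC adjoin_int adjoin_int_subring_closed.

Lemma adjoin_int_gen : xi \in adjoin_int.
Proof. by apply/asboolP; exists 'X; rewrite map_polyX hornerX. Qed.

(* Z[xi], with [algC] (where characters take their values) in the role of the
   complex numbers. *)
Record Zxi := MkZxi { zxi_val : algC; zxi_valP : zxi_val \in adjoin_int }.

HB.instance Definition _ := [isSub for zxi_val].
HB.instance Definition _ := [Choice of Zxi by <:].
HB.instance Definition _ := [SubChoice_isSubComNzRing of Zxi by <:].

End AdjoinInt.

Section Rbar.
Variables (gT : finGroupType) (G : {group gT}) (xi : algC).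

Definition rbar : {pred 'CF(G)} := fun phi =>
  `[< exists a : Iirr G -> Zxi xi, phi = \sum_i zxi_val (a i) *: 'chi_i >].

Lemma rbarP (phi : 'CF(G)) :
  reflect (exists2 a : Iirr G -> algC, forall i, a i \in adjoin_int xi
           & phi = \sum_i a i *: 'chi_i)
          (phi \in rbar).
Proof.
apply: (iffP (asboolP _)) => [[a ->]|[a aP ->]].
  by exists (fun i => zxi_val (a i)) => // i; apply: zxi_valP.
by exists (fun i => MkZxi (aP i)).
Qed.

Lemma rbar_zmod_closed : zmod_closed rbar.
Proof.
split.
  apply/rbarP; exists (fun=> 0) => [i|]; first exact: rpred0.
  by rewrite big1 // => i _; rewrite scale0r.
move=> u v /rbarP[a aP ->] /rbarP[b bP ->]; apply/rbarP.
exists (fun i => a i - b i) => [i|]; first exact: rpredB.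
by rewrite -sumrB; apply: eq_bigr => i _; rewrite scalerBl.
Qed.

HB.instance Definition _ := GRing.isZmodClosed.Build 'CF(G) rbar rbar_zmod_closed.

Lemma rbar_scale z phi :
  z \in adjoin_int xi -> phi \in rbar -> z *: phi \in rbar.
Proof.
move=> zP /rbarP[a aP ->]; apply/rbarP; exists (fun i => z * a i) => [i|].
  exact: rpredM.
by rewrite scaler_sumr; apply: eq_bigr => i _; rewrite scalerA.
Qed.

Lemma rbar_char phi : phi \is a character -> phi \in rbar.
Proof.
move=> chi_phi; apply/rbarP; exists (fun i => '[phi, 'chi_i]) => [i|].
  by have /natrP[k ->] := Cnat_cfdot_char_irr i chi_phi; apply: rpred_nat.
exact: cfun_sum_cfdot.
Qed.

Lemma rbar_subring_closed : subring_closed rbar.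
Proof.
split; first by apply: rbar_char; rewrite rpred1.
  by move=> u v; apply: rpredB.
move=> u v /rbarP[a aP ->] /rbarP[b bP ->].
rewrite mulr_suml; apply: rpred_sum => i _.
rewrite mulr_sumr; apply: rpred_sum => j _.
rewrite -scalerAl -scalerAr; do 2!apply: rbar_scale => //.
by apply: rbar_char; rewrite rpredM ?irr_char.
Qed.

HB.instance Definition _ :=
  GRing.isSubringClosed.Build 'CF(G) rbar rbar_subring_closed.

(* R(G) tensored with Z[xi], identified with the ring of Z[xi]-linear
   combinations of irreducible characters. *)
Record Rbar := MkRbar { rbar_val : 'CF(G); rbar_valP : rbar_val \in rbar }.

HB.instance Definition _ := [isSub for rbar_val].
HB.instance Definition _ := [Choice of Rbar by <:].
HB.instance Definition _ := [SubChoice_isSubComNzRing of Rbar by <:].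

End Rbar.

Definition Cl (gT : finGroupType) (G : {group gT}) : Type :=
  {c : {set gT} | c \in classes G}.

Section Evaluation.
Variables (gT : finGroupType) (G : {group gT}) (xi : algC).
Hypothesis xi_prim : #|G|.-primitive_root xi.

Lemma char_adjoin_int (phi : 'CF(G)) x :
  phi \is a character -> phi x \in adjoin_int xi.
Proof.
have [Gx|nGx _] := boolP (x \in G); last by rewrite cfun0 // rpred0.
case/char_reprP => rG ->.
have [e [_ [e1 _] [-> _] _]] := repr_rsim_diag rG Gx.
apply: rpred_sum => i _.
have : e 0 i ^+ #|G| = 1.
  by have /dvdnP[k ->] := order_dvdG Gx; rewrite mulnC exprM e1 expr1n.
case/(prim_rootP xi_prim) => k ->; apply: rpredX; exact: adjoin_int_gen.
Qed.

Lemma rbar_adjoin_int (phi : Rbar G xi) x : rbar_val phi x \in adjoin_int xi.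
Proof.
have /rbarP[a aP ->] := rbar_valP phi; rewrite sum_cfunE.
apply: rpred_sum => i _; rewrite cfunE; apply: rpredM => //.
exact/char_adjoin_int/irr_char.
Qed.

Variable c : Cl G.

(* The value on the class c is taken at a representative. *)
Definition class_eval (phi : Rbar G xi) : Zxi xi :=
  MkZxi (rbar_adjoin_int phi (fingroup.repr (sval c))).

Lemma class_eval_zmod_morphism : zmod_morphism class_eval.
Proof. by move=> u v; apply: val_inj; rewrite /= !cfunE. Qed.

Lemma class_eval_monoid_morphism : monoid_morphism class_eval.
Proof.
split=> [|u v]; apply: val_inj; rewrite /= ?cfunE // cfun1E.
have /imsetP[x Gx cE] := svalP c; rewrite cE.
by have [y Gy ->] := repr_class G x; rewrite groupJ.
Qed.

HB.instance Definition _ := GRing.isZmodMorphism.Build (Rbar G xi) (Zxi xi)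
  class_eval class_eval_zmod_morphism.
HB.instance Definition _ := GRing.isMonoidMorphism.Build (Rbar G xi) (Zxi xi)
  class_eval class_eval_monoid_morphism.

(* The prime ideal of those chi such that chi(c) is in Q. *)
Definition class_point (Q : spec (Zxi xi)) : spec (Rbar G xi) :=
  spec_map class_eval Q.

End Evaluation.

(* g.`_p^' is the p-regular part of g; both g.`_p and g.`_p^' are powers of g, and
   g = g.`_p * g.`_p^'. *)
Definition reg_class (gT : finGroupType) (G : {group gT}) (p : nat)
    (c : Cl G) : {set gT} :=
  [set (g.`_p^')%g | g in sval c].

(* Main.v *)
Require Import Defs.
From HB Require Import structures.
From mathcomp Require Import all_boot all_order all_algebra all_fingroup.
From mathcomp Require Import all_solvable all_field all_character.
From mathcomp Require Import generic_quotient ring_quotient.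
From mathcomp Require Import boolp classical_sets topology_structure.
From mathcomp Require Import ring.

Set Implicit Arguments.
Unset Strict Implicit.
Unset Printing Implicit Defensive.
Import GRing.Theory Num.Theory.

Local Open Scope ring_scope.

(** Write O for Z[xi] and A for the ring of O-combinations of irreducible
    characters.  Evaluation at the classes embeds A in O^Cl(G), so that Spec A
    is a union of copies of Spec O, one for each class, glued along points.
    The kernels of the evaluations ([branch]) are the minimal primes of A: the
    intersection of all of them is 0, and [class_sum], which vanishes at every
    class but one, shows that none contains another.  Thus the components
    are the sets of primes above a branch, and P lies on two of them iff it
    contains the branch of some d <> c ([in_two_components_classP]).  Since
    constants belong to A, this means that phi(c) = phi(d) modulo Q for
    all phi ([branch_sub_point]).

    (ii) => (iii).  Congruence of all character values at c and d modulo Q is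
    equality of the p-regular classes ([class_cong_iff]).  On the one hand
    phi(g) = phi(g_r) modulo Q ([rbar_cong]), because a root of unity of
    p-power order is 1 modulo Q.  On the other hand Brauer's construction
    of inducing from <g> x S, where S is a Sylow p-subgroup of the centralizer
    of a p-regular g, gives an element of A whose value at g is an index prime
    to p and which vanishes at the other p-regular classes
    ([p'_separating]).  If Q = 0, all characters agree on c and d and c = d.

    (i) => (ii).  If the branch of c is the only one through P, an element
    of A outside P kills that branch ([isolating_element]); hence the local ring
    at P is that of O at Q, so it is a field if Q = 0 and otherwise a discrete
    valuation ring.  The latter is the arithmetic input.  If n = m p^a with m
    prime to p, take pi = 1 - xi^m, which is one minus a primitive p^a-th
    root of unity (pi = p if a = 0).  Modulo pi the ring O is generated by
    an m-th root of unity in characteristic p, so x^q = x modulo pi for a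
    suitable power q of p ([uniformizer_exists]).  For x in Q this reads
    x (1 - x^(q-1)) = 0 modulo pi, with 1 - x^(q-1) outside Q; so pi generates Q
    locally ([zxi_dvr]).  The same identity shows that nonzero primes of O
    are maximal, so A has dimension 1.

    (iii) => (i).  If the branch of d <> c also passes through P and Q <> 0,
    the Krull dimension at P is 1, but pi and an element x of the branch of c
    with x(d) of least valuation are independent in m/m^2
    ([singular_crossing]): a relation evaluated at c shows that the
    coefficient of pi lies in m, and x is not in m^2 because on m^2 the
    difference of the values at d and at c has larger valuation than x(d) has.

    (II) follows, since taking p-regular parts does nothing when p does not
    divide the order of G. *)

(** * Prime ideals *)

Section PrimeIdeals.
Variables (A : comNzRingType) (P : spec A).

Lemma spec_mulr a b : a \in (P : pred A) -> a * b \in (P : pred A).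
Proof. by move=> aP; rewrite mulrC (idealMr b aP). Qed.

Lemma spec_prod (I : finType) (F : I -> A) :
  \prod_i F i \in (P : pred A) -> exists i, F i \in (P : pred A).
Proof.
move=> FP; apply: contrapT => /forallNP nF; move: FP; apply/negP.
elim/big_ind: _ => [|x y xP yP|i _]; first by rewrite idealr1.
  by rewrite prime_idealrM negb_or xP.
exact/negP.
Qed.

Lemma spec_exp x k : x ^+ k \in (P : pred A) -> x \in (P : pred A).
Proof.
elim: k => [|k IHk]; first by rewrite expr0 idealr1.
by rewrite exprS prime_idealrM => /orP[].
Qed.

End PrimeIdeals.

Section ZeroPrime.
Variable O : comNzRingType.
Hypothesis domO : forall x y : O, x * y = 0 -> x = 0 \/ y = 0.

Lemma zero_idealr_closed : idealr_closed (pred1 (0 : O)).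
Proof.
split=> [||a x y /eqP-> /eqP->]; rewrite ?inE ?eqxx ?oner_eq0 //.
by rewrite mulr0 addr0 eqxx.
Qed.

Lemma zero_prime_closed : prime_idealr_closed (pred1 (0 : O)).
Proof.
by move=> x y /eqP /domO[] ->; rewrite !inE eqxx ?orbT.
Qed.

Definition zero_spec : spec O := Spec zero_idealr_closed zero_prime_closed.

End ZeroPrime.

(** * Localization at a prime *)

Section LocalRing.
Variables (A : comNzRingType) (P : spec A).
Local Notation L := (localization P).
Local Notation m := (loc_max_ideal P).

Lemma loc_fracD a s b t :
  loc_frac a s + loc_frac b t = loc_frac (a * den t + b * den s) (denomM s t) :> L.
Proof. exact: loc_addE. Qed.

Lemma loc_fracM a s b t :
  loc_frac a s * loc_frac b t = loc_frac (a * b) (denomM s t) :> L.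
Proof. exact: loc_mulE. Qed.

Lemma loc_frac_eq0 a s :
  loc_frac a s = 0 :> L <-> exists t : denom P, den t * a = 0.
Proof.
rewrite -[0]/(loc_frac 0 (denom1 P)) loc_fracP /=.
by split=> -[t e]; exists t; move: e; rewrite mulr1 mul0r mulr0.
Qed.

Definition loc_of (a : A) : L := loc_frac a (denom1 P).

Lemma loc_of_zmod_morphism : zmod_morphism loc_of.
Proof.
move=> a b; have -> : - loc_of b = loc_frac (- b) (denom1 P) by exact: loc_oppE.
rewrite loc_fracD.
by apply/loc_fracP; exists (denom1 P); rewrite /=; ring.
Qed.

Lemma loc_of_monoid_morphism : monoid_morphism loc_of.
Proof.
split=> // a b; rewrite loc_fracM.
by apply/loc_fracP; exists (denom1 P); rewrite /=; ring.
Qed.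

HB.instance Definition _ := GRing.isZmodMorphism.Build A L loc_of
  loc_of_zmod_morphism.
HB.instance Definition _ := GRing.isMonoidMorphism.Build A L loc_of
  loc_of_monoid_morphism.

Lemma loc_fracE1 a s : loc_frac a s = loc_frac 1 s * loc_of a :> L.
Proof. by rewrite loc_fracM; apply/loc_fracP; exists (denom1 P); rewrite /=; ring. Qed.

Lemma loc_of_frac a s : loc_of a = loc_frac a s * loc_of (den s).
Proof. by rewrite loc_fracM; apply/loc_fracP; exists (denom1 P); rewrite /=; ring. Qed.

Lemma mem_loc_frac (R : spec L) a s :
  (loc_frac a s \in (R : pred L)) = (loc_of a \in (R : pred L)).
Proof.
apply/idP/idP; first by rewrite (loc_of_frac a s); apply: spec_mulr.
by rewrite loc_fracE1; apply: idealMr.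
Qed.

Section ExtendPrime.
Variables (R : spec A) (sRP : {subset (R : pred A) <= (P : pred A)}).

Definition loc_ext_pred : L -> bool := fun x =>
  `[< exists (a : A) (s : denom P), a \in (R : pred A) /\ x = loc_frac a s >].

(** Membership of a fraction does not depend on how it is written, because [R],
    being contained in [P], avoids all denominators. *)
Lemma mem_loc_ext a s : (loc_frac a s \in loc_ext_pred) = (a \in (R : pred A)).
Proof.
apply/asboolP/idP => [[b [t [bR /loc_fracP[u e]]]]|aR]; last by exists a, s.
have: den u * (a * den t) \in (R : pred A) by rewrite e idealMr // spec_mulr.
have denR (v : denom P) : (den v \in (R : pred A)) = false.
  by apply: contraNF (denP v); apply: sRP.
by rewrite !prime_idealrM !denR orbF.
Qed.

Lemma loc_ext_idealr_closed : idealr_closed loc_ext_pred.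
Proof.
split; first by rewrite (mem_loc_ext 0 (denom1 P)) idealr0.
  by rewrite (mem_loc_ext 1 (denom1 P)) idealr1.
elim/loc_ind=> a s; elim/loc_ind=> b t; elim/loc_ind=> c u.
rewrite loc_fracM loc_fracD !mem_loc_ext => bR cR.
by rewrite rpredD // spec_mulr // idealMr.
Qed.

Lemma loc_ext_prime_closed : prime_idealr_closed loc_ext_pred.
Proof.
elim/loc_ind=> a s; elim/loc_ind=> b t.
by rewrite loc_fracM !mem_loc_ext prime_idealrM.
Qed.

Definition loc_ext : spec L := Spec loc_ext_idealr_closed loc_ext_prime_closed.

End ExtendPrime.

Lemma mem_loc_max a s : (loc_frac a s \in (m : pred L)) = (a \in (P : pred A)).
Proof. exact: (@mem_loc_ext P (fun _ => id)). Qed.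

Lemma loc_unit x : x \notin (m : pred L) -> exists y, x * y = 1.
Proof.
elim/loc_ind: x => a s; rewrite mem_loc_max => aP.
exists (loc_frac (den s) (Denom aP)); rewrite loc_fracM.
by apply/loc_fracP; exists (denom1 P); rewrite /=; ring.
Qed.

Lemma loc_of_subset (R : spec L) :
  {subset (spec_map loc_of R : pred A) <= (P : pred A)}.
Proof.
move=> a; rewrite preim_predE => aR; apply: contraT => aP.
have: loc_frac a (Denom aP) \in (R : pred L) by rewrite mem_loc_frac.
have -> : loc_frac a (Denom aP) = 1.
  by apply/loc_fracP; exists (denom1 P); rewrite /=; ring.
by rewrite idealr1.
Qed.

(** Chains of primes contained in [P] compute the Krull dimension of the local
    ring ([prime_chain_loc]) without leaving [A]. *)
Definition chain_below (e : nat) : Prop :=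
  exists R : 'I_e.+1 -> spec A,
    (forall i j : 'I_e.+1, (i < j)%N ->
      {subset (R i : pred A) <= (R j : pred A)} /\
      ~ {subset (R j : pred A) <= (R i : pred A)}) /\
    forall i, {subset (R i : pred A) <= (P : pred A)}.

Lemma prime_chain_loc e : prime_chain L e <-> chain_below e.
Proof.
split=> [[R Rch]|[R [Rch RP]]].
  exists (fun i => spec_map loc_of (R i)); split=> [i j /Rch[Rij nRji]|i].
    split=> [a|sji]; first by rewrite !preim_predE; apply: Rij.
    apply: nRji; elim/loc_ind=> a s; rewrite !mem_loc_frac => aj.
    by have := sji a; rewrite !preim_predE; apply.
  exact: loc_of_subset.
exists (fun i => loc_ext (RP i)) => i j /Rch[Rij nRji]; split.
  by elim/loc_ind=> a s; rewrite !mem_loc_ext //; apply: Rij.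
by move=> sji; apply: nRji => a; have := sji (loc_of a); rewrite !mem_loc_ext.
Qed.

(** To keep an element of the local ring out of the square of its maximal ideal,
    it suffices to find an ideal [J] of [A] that contains the products of two
    elements of [P] and no multiple of the numerator by an element outside
    [P]. *)
Lemma loc_max_sq (J : A -> Prop) :
    J 0 -> (forall a b, J a -> J b -> J (a + b)) ->
    (forall a b, J b -> J (a * b)) ->
    (forall a b, a \in (P : pred A) -> b \in (P : pred A) -> J (a * b)) ->
  forall (z : ideal_elt m) a s, z \in @ideal_sq L m -> ielt z = loc_frac a s ->
  exists2 t, t \notin (P : pred A) & J (t * a).
Proof.
move=> J0 JD JM JP z a s /asboolP[k [x [y ->]]].
have [w [t [Jw ->]]] : exists w t, J w /\
    \sum_(i < k) ielt (x i) * ielt (y i) = loc_frac w t.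
  elim: k x y => [|k IHk] x y.
    by exists 0, (denom1 P); rewrite big_ord0.
  rewrite big_ord_recl.
  have [w [t [Jw ->]]] := IHk (fun i => x (lift ord0 i)) (fun i => y (lift ord0 i)).
  have /asboolP[b [u [bP ->]]] := ieltP (x ord0).
  have /asboolP[c [v [cP ->]]] := ieltP (y ord0).
  rewrite loc_fracM loc_fracD; do 2!eexists; split=> //.
  by apply: JD; rewrite mulrC; apply: JM => //; apply: JP.
move/loc_fracP=> [u e]; exists (den (denomM u t)); first exact: denP.
suff -> : den (denomM u t) * a = den u * den s * w by apply: JM.
by rewrite /=; transitivity (den u * (a * den t)); [ring|rewrite -e; ring].
Qed.

End LocalRing.

(** * Dimension of the cotangent space *)

Section CotangentDim.
Variables (L : comNzRingType) (m : idealr L).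
Local Open Scope quotient_scope.
Local Notation K := {ideal_quot m}.
Local Notation V := (cotangent m).
Local Notation piV x := (\pi_V x : V).

Lemma pi_ideal_eq0 (a : L) : (\pi_K a == 0 :> K) = (a \in (m : pred L)).
Proof. by rewrite -(rmorph0 \pi_K) -Quotient.idealrBE subr0. Qed.

Lemma pi_cot_eq0 (x : ideal_elt m) : piV x = 0 <-> x \in @ideal_sq L m.
Proof. by rewrite -(raddf0 \pi_V) cot_eqP subr0. Qed.

Lemma scale_piE (a : L) (x : ideal_elt m) :
  \pi_K a *: piV x = piV (ideal_scale a x).
Proof. exact: cot_scaleE. Qed.

Lemma cotangent_dim0 : (forall x, x \in (m : pred L) -> x = 0) -> has_dim V 0.
Proof.
move=> m0; apply: inhabits; exists (fun _ => 0) => [a u v|].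
  by rewrite scaler0 addr0.
exists (fun _ => 0) => [v|r]; last by rewrite [r]thinmx0.
elim/quotW: v => x; apply/esym/pi_cot_eq0.
suff -> : x = 0 by apply: rpred0.
apply: val_inj; transitivity (0 : L); first exact: m0 (ieltP x).
exact/esym/(raddf0 (val : ideal_elt m -> L)).
Qed.

(** When [t] generates [m], the map [a |-> a t] from the residue field onto
    [m / m^2] is injective: if [a t] lies in [m^2] with [a] a unit, so
    does [t]. *)
Lemma cotangent_dim1 (t : ideal_elt m) :
    (forall x, x \notin (m : pred L) -> exists y, x * y = 1) ->
    (forall x, x \in (m : pred L) -> exists y, x = y * ielt t) ->
    t \notin @ideal_sq L m -> has_dim V 1.
Proof.
move=> unitL gen_t nt.
have surj (v : V) : exists a : K, v = a *: piV t.
  elim/quotW: v => x; have [y xE] := gen_t _ (ieltP x).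
  exists (\pi_K y); rewrite scale_piE; congr (\pi_V _).
  exact: val_inj.
have inj (a b : K) : a *: (piV t) = b *: (piV t) -> a = b.
  move=> /eqP; rewrite -subr_eq0 -scalerBl => ab0; apply/eqP.
  rewrite -subr_eq0; move: (a - b) ab0 => {a b}; elim/quotW => a.
  rewrite scale_piE pi_ideal_eq0 => /eqP/pi_cot_eq0 at_sq.
  apply: contraNT nt => /unitL[b ab1].
  suff -> : t = ideal_scale b (ideal_scale a t) by apply: ideal_sq_scale.
  by apply: val_inj; rewrite /= mulrA (mulrC b) ab1 mul1r.
have [f fE] := choice surj.
apply: inhabits; exists (fun v => const_mx (f v)) => [a u v|].
  apply/rowP=> i; rewrite !mxE; apply: inj.
  by rewrite -fE scalerDl -scalerA -!fE.
exists (fun r : 'rV[K]_1 => r 0 0 *: (piV t)) => [v|r]; first by rewrite mxE -fE.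
by apply/rowP=> i; rewrite mxE (ord1 i); apply: inj; rewrite -fE.
Qed.

(** Two vectors of a line are dependent; the relation is stated with
    coefficients lifted to [L], and the coefficient of [x] is a coordinate of
    the nonzero vector [y]. *)
Lemma cotangent_dim1_dep (x y : ideal_elt m) :
    has_dim V 1 -> y \notin @ideal_sq L m ->
  exists a b : L, b \notin (m : pred L) /\
    ideal_scale b x - ideal_scale a y \in @ideal_sq L m.
Proof.
move=> [[f lin_f [g fK gK]]] ny.
have fZ (c : K) v : f (c *: v) = c *: f v.
  have f0 : f 0 = 0 by have := lin_f (-1) 0 0; rewrite !scaleN1r oppr0 addr0 addNr.
  by have := lin_f c v 0; rewrite f0 !addr0.
have [a aE] : exists a : L, \pi_K a = f (piV x) 0 0.
  by exists (repr (f (piV x) 0 0)); rewrite reprK.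
have [b bE] : exists b : L, \pi_K b = f (piV y) 0 0.
  by exists (repr (f (piV y) 0 0)); rewrite reprK.
exists a, b; split.
  apply: contra ny; rewrite -pi_ideal_eq0 bE => /eqP fy0.
  apply/pi_cot_eq0; rewrite -[piV y]fK -[0]fK; congr (g _).
  apply/rowP=> i; rewrite (ord1 i) fy0.
  by rewrite -(scale0r (0 : V)) fZ scale0r mxE.
apply/cot_eqP; rewrite -!scale_piE -[LHS]fK -[RHS]fK !fZ; congr (g _).
by apply/rowP=> i; rewrite (ord1 i) !mxE aE bE mulrC.
Qed.

End CotangentDim.

(** * Irreducible components of a spectrum with finitely many minimal primes *)

Section Components.
Variables (A : comNzRingType) (I : finType) (p : I -> spec A).
Hypothesis p_minimal : forall R : spec A,
  exists i, {subset (p i : pred A) <= (R : pred A)}.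
Hypothesis p_incomparable : forall i j,
  {subset (p i : pred A) <= (p j : pred A)} -> i = j.
Local Open Scope classical_set_scope.

Lemma zariski_V_closed (E : set A) : closed (zariski_V E).
Proof.
rewrite -[zariski_V E]setCK closedC.
by exists E.
Qed.

Lemma closed_zariski_V (F : set (spec A)) : closed F -> exists E, F = zariski_V E.
Proof.
move=> /closed_openC[E FE]; exists E.
by rewrite -[F]setCK FE setCK.
Qed.

Definition prime_closure (i : I) : set (spec A) :=
  zariski_V (fun f => f \in (p i : pred A)).

Lemma irreducible_prime_closure i : irreducible (prime_closure i).
Proof.
split=> [|F1 F2 /closed_zariski_V[E1 ->] /closed_zariski_V[E2 ->] cov].
  by exists (p i) => f.
have /cov[h|h] : prime_closure i (p i) by move=> f.
  by left=> R iR f /h /iR.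
by right=> R iR f /h /iR.
Qed.

(** The spectrum is a finite union of the closed sets [prime_closure i]; an
    irreducible set lies in one of them, by induction on a list of indices whose
    closed sets cover it. *)
Lemma irreducible_sub_prime_closure Z :
  irreducible Z -> exists i, Z `<=` prime_closure i.
Proof.
case=> -[R0 ZR0] irrZ.
have: exists s : seq I, Z `<=` [set R | exists2 i, i \in s & prime_closure i R].
  exists (enum I) => R _; have [i iR] := p_minimal R.
  by exists i; rewrite ?mem_enum.
case=> s; elim: s => [|i s IHs] Zs; first by have [] := Zs _ ZR0.
have clF (t : seq I) : closed [set R | exists2 j, j \in t & prime_closure j R].
  elim: t => [|j t IHt].
    rewrite (_ : [set R | _] = set0); first exact: closed0.
    by apply/seteqP; split=> // R [].
  rewrite (_ : [set R | _] =
    prime_closure j `|` [set R | exists2 j, j \in t & prime_closure j R]).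
    by apply: closedU => //; apply: zariski_V_closed.
  apply/seteqP; split=> R.
    case=> l; rewrite inE => /orP[/eqP->|lt] lR; [by left|right].
    by exists l.
  case=> [jR|[l lt lR]]; first by exists j; rewrite ?mem_head.
  by exists l; rewrite // inE lt orbT.
case: (irrZ (prime_closure i) _ (@zariski_V_closed _) (clF s)).
- move=> R /Zs[j]; rewrite inE => /orP[/eqP->|js] jR; first by left.
  by right; exists j.
- by exists i.
- exact: IHs.
Qed.

Lemma irreducible_componentP Z :
  irreducible_component Z <-> exists i, Z = prime_closure i.
Proof.
split=> [[irrZ maxZ]|[i ->]].
  have [i Zi] := irreducible_sub_prime_closure irrZ; exists i.
  by rewrite (maxZ _ (irreducible_prime_closure i) Zi).
split=> [|Y irrY iY]; first exact: irreducible_prime_closure.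
have [j Yj] := irreducible_sub_prime_closure irrY.
have ij : j = i by apply: p_incomparable; apply: (Yj); apply: iY => f.
by apply/seteqP; split=> //; rewrite -ij.
Qed.

Lemma in_two_componentsP (P : spec A) :
  in_two_components P <-> exists i j, [/\ i != j,
    {subset (p i : pred A) <= (P : pred A)} &
    {subset (p j : pred A) <= (P : pred A)}].
Proof.
split=> [[Z1 [Z2 [/irreducible_componentP[i ->] /irreducible_componentP[j ->]]]]|].
  move=> nij iP jP; exists i, j; split=> //.
  by apply/eqP => ij; apply: nij; rewrite ij.
case=> i [j [/eqP nij iP jP]]; exists (prime_closure i), (prime_closure j); split=> //.
- by apply/irreducible_componentP; exists i.
- by apply/irreducible_componentP; exists j.
move=> ij; apply: nij; apply/esym/p_incomparable.
have : prime_closure j (p i) by rewrite -ij => f.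
exact.
Qed.

End Components.

(** * Divisibility by powers of a local generator of a prime *)

Section Valuation.
Variables (O : comNzRingType) (Q : spec O) (pi : O).
Hypothesis domO : forall x y : O, x * y = 0 -> x = 0 \/ y = 0.
Hypothesis pi_neq0 : pi <> 0.
Hypothesis piQ : pi \in (Q : pred O).

(** The image of [x] in the local ring at [Q] is divisible by [pi ^+ k]; when
    [pi] generates [Q] locally, this says that the valuation of [x] is at least
    [k]. *)
Definition val_ge (k : nat) (x : O) : Prop :=
  exists s y, s \notin (Q : pred O) /\ s * x = pi ^+ k * y.

Hypothesis pi_gen : forall x, x \in (Q : pred O) -> val_ge 1 x.

Lemma val_ge0 x : val_ge 0 x.
Proof. by exists 1, x; rewrite idealr1 !mul1r. Qed.

Lemma val_ge_zero k : val_ge k 0.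
Proof. by exists 1, 0; rewrite idealr1 !mulr0. Qed.

Lemma val_geD k x y : val_ge k x -> val_ge k y -> val_ge k (x + y).
Proof.
move=> [s [a [sQ e]]] [t [b [tQ f]]]; exists (s * t), (t * a + s * b).
rewrite prime_idealrM negb_or sQ tQ; split=> //.
transitivity (t * (s * x) + s * (t * y)); first by ring.
by rewrite e f; ring.
Qed.

Lemma val_geM j k x y : val_ge j x -> val_ge k y -> val_ge (j + k) (x * y).
Proof.
move=> [s [a [sQ e]]] [t [b [tQ f]]]; exists (s * t), (a * b).
rewrite prime_idealrM negb_or sQ tQ; split=> //.
transitivity ((s * x) * (t * y)); first by ring.
by rewrite e f exprD; ring.
Qed.

Lemma val_ge_mull k a x : val_ge k x -> val_ge k (a * x).
Proof. exact: val_geM (val_ge0 a). Qed.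

Lemma val_ge1P x : val_ge 1 x <-> x \in (Q : pred O).
Proof.
split=> [[s [y [sQ e]]]|]; last exact: pi_gen.
have: s * x \in (Q : pred O) by rewrite e expr1 spec_mulr.
by rewrite prime_idealrM (negPf sQ).
Qed.

Lemma val_ge_cancel k s x : s \notin (Q : pred O) -> val_ge k (s * x) -> val_ge k x.
Proof.
move=> sQ [t [y [tQ e]]]; exists (t * s), y.
by rewrite prime_idealrM negb_or sQ tQ -mulrA e.
Qed.

Lemma val_ge_pi k x : val_ge k.+1 (x * pi) -> val_ge k x.
Proof.
move=> [s [y [sQ e]]]; exists s, y; split=> //.
have: pi * (s * x - pi ^+ k * y) = 0.
  by rewrite mulrBr [pi * (_ ^+ _ * _)]mulrA -exprS -e; ring.
by case/domO=> [/pi_neq0//|/eqP]; rewrite subr_eq0 => /eqP.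
Qed.

Lemma val_pi_lt2 s : s \notin (Q : pred O) -> ~ val_ge 2 (s * pi).
Proof. by move=> sQ /val_ge_pi/val_ge1P; apply/negP. Qed.

End Valuation.

(** * Curves whose branches are copies of one Dedekind spectrum *)

(** [A] is a ring of functions on the finite set [I] with values in the domain
    [O], given by the evaluations [ev i]; it contains the constants and, for
    every [i], a function [delta i] supported at [i] only. *)
Section Curve.
Variables (A O : comNzRingType) (I : finType).
Variables (ev : I -> {rmorphism A -> O}) (cst : {rmorphism O -> A}).
Variable delta : I -> A.
Hypothesis domO : forall x y : O, x * y = 0 -> x = 0 \/ y = 0.
Hypothesis evK : forall i x, ev i (cst x) = x.
Hypothesis ev_inj : forall a, (forall i, ev i a = 0) -> a = 0.
Hypothesis delta_diag : forall i, ev i (delta i) <> 0.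
Hypothesis delta_off : forall i j, i != j -> ev j (delta i) = 0.
Hypothesis nonzero_prime_max : forall (Q1 Q2 : spec O) x,
  x <> 0 -> x \in (Q1 : pred O) -> {subset (Q1 : pred O) <= (Q2 : pred O)} ->
  {subset (Q2 : pred O) <= (Q1 : pred O)}.

Definition branch (i : I) : spec A := spec_map (ev i) (zero_spec domO).

Lemma mem_branch i a : (a \in (branch i : pred A)) = (ev i a == 0).
Proof. by []. Qed.

(** A product of elements, one from each branch, vanishes everywhere. *)
Lemma branch_below (R : spec A) :
  exists i, {subset (branch i : pred A) <= (R : pred A)}.
Proof.
apply: contrapT => /forallNP nR.
have /choice[x xP] i : exists x, ev i x = 0 /\ x \notin (R : pred A).
  have /existsNP[x /not_implyP[]] := nR i.
  by rewrite mem_branch => /eqP xi /negP xR; exists x.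
have /spec_prod[i] : \prod_i x i \in (R : pred A).
  rewrite (@ev_inj (\prod_i x i)) ?idealr0 // => i.
  by rewrite (bigD1 i) //= rmorphM (xP i).1 mul0r.
by apply/negP; have [] := xP i.
Qed.

Lemma branch_incomparable i j :
  {subset (branch i : pred A) <= (branch j : pred A)} -> i = j.
Proof.
move=> sij; apply: contrapT => /eqP; rewrite eq_sym => nij.
have := sij (delta j); rewrite !mem_branch delta_off // eqxx => /(_ isT)/eqP.
exact: delta_diag.
Qed.

Lemma sub_cst_branch i a : a - cst (ev i a) \in (branch i : pred A).
Proof. by rewrite mem_branch rmorphB evK subrr. Qed.

Lemma mem_above_branch (R : spec A) i a :
    {subset (branch i : pred A) <= (R : pred A)} ->
  (a \in (R : pred A)) = (cst (ev i a) \in (R : pred A)).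
Proof.
move=> /(_ _ (sub_cst_branch i a)) aR.
by rewrite -[in LHS](subrK (cst (ev i a)) a) rpredDl.
Qed.

Variables (Q : spec O) (c : I).
Local Notation P := (spec_map (ev c) Q).

Lemma mem_point a : (a \in (P : pred A)) = (ev c a \in (Q : pred O)).
Proof. by []. Qed.

Lemma branch_sub_point i :
  {subset (branch i : pred A) <= (P : pred A)} <->
  forall a, ev c a - ev i a \in (Q : pred O).
Proof.
split=> [sP a|cong a].
  by have := sP _ (sub_cst_branch i a); rewrite mem_point rmorphB evK.
rewrite mem_branch mem_point => /eqP ai.
by have := cong a; rewrite ai subr0.
Qed.

Lemma center_branch_sub : {subset (branch c : pred A) <= (P : pred A)}.
Proof. by apply/branch_sub_point => a; rewrite subrr idealr0. Qed.

Lemma krull_dim_generic_point :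
  (Q : pred O) =i pred1 0 ->
  (forall i, i != c -> ~ {subset (branch i : pred A) <= (P : pred A)}) ->
  has_krull_dim (localization P) 0.
Proof.
move=> Q0 sep; split=> [|e].
  apply/prime_chain_loc; by exists (fun _ => P); split=> [[[|i] Hi] [[|j] Hj]|i a].
case: e => // e /prime_chain_loc[R [Rch RP]]; exfalso.
have [i iR] := branch_below (R ord0).
have ic : i = c.
  by apply/eqP; apply: contraT => /sep[] a /iR; apply: RP.
have [_ []] := Rch ord0 ord_max (ltn0Sn _).
move=> a /RP; rewrite mem_point Q0 inE => ac; apply: iR.
by rewrite ic mem_branch.
Qed.

(** Above a branch, primes of [A] are determined by their constants, so a chain
    of three primes of [A] would give a chain of two nonzero primes of [O]. *)
Lemma krull_dim_closed_point x0 :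
  x0 <> 0 -> x0 \in (Q : pred O) -> has_krull_dim (localization P) 1.
Proof.
move=> x0_neq0 x0Q; split=> [|e].
  apply/prime_chain_loc.
  exists (fun i : 'I_2 => if i == ord0 then branch c else P); split.
    move=> i j ij; have [-> ->] : (i == ord0) = true /\ (j == ord0) = false.
      by case: i j ij => [[|[|i]] Hi] [[|[|j]] Hj].
    split; first exact: center_branch_sub.
    move=> /(_ (cst x0)); rewrite mem_point mem_branch evK => /(_ x0Q)/eqP.
    exact: x0_neq0.
  by move=> i a; case: ifP => // _; apply: center_branch_sub.
case: e => [|[|e]] // /prime_chain_loc[R [Rch RP]]; exfalso.
pose R1 := R (inord 1); pose R2 := R (inord 2).
have [sub01 nsub10] : {subset (R ord0 : pred A) <= (R1 : pred A)} /\
    ~ {subset (R1 : pred A) <= (R ord0 : pred A)} by apply: Rch; rewrite inordK.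
have [sub12 nsub21] : {subset (R1 : pred A) <= (R2 : pred A)} /\
    ~ {subset (R2 : pred A) <= (R1 : pred A)} by apply: Rch; rewrite !inordK.
have [i iR0] := branch_below (R ord0).
have iR1 : {subset (branch i : pred A) <= (R1 : pred A)} by move=> a /iR0/sub01.
have iR2 : {subset (branch i : pred A) <= (R2 : pred A)} by move=> a /iR1/sub12.
have [a aR1 aR0] : exists2 a, a \in (R1 : pred A) & a \notin (R ord0 : pred A).
  apply: contrapT => h; apply: nsub10 => a aR1; apply: contraT => aR0.
  by case: h; exists a.
apply: nsub21 => b; rewrite (mem_above_branch b iR1) (mem_above_branch b iR2).
apply: (@nonzero_prime_max (spec_map cst R1) (spec_map cst R2) (ev i a)).
- by move=> ai0; move/negP: aR0; apply; apply: iR0; rewrite mem_branch ai0.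
- by rewrite preim_predE -mem_above_branch.
- by move=> y; rewrite !preim_predE; apply: sub12.
Qed.

(** For each other branch, take a function that vanishes on it and lies outside
    [P]; the product [y] is supported at [c], so it kills the functions that
    vanish at [c]. *)
Lemma isolating_element :
  (forall i, i != c -> ~ {subset (branch i : pred A) <= (P : pred A)}) ->
  exists2 y, y \notin (P : pred A) & forall x, x \in (branch c : pred A) -> y * x = 0.
Proof.
move=> sep.
have /choice[y yP] i : exists y, y \notin (P : pred A) /\ (i != c -> ev i y = 0).
  have [->|ic] := eqVneq i c; first by exists 1; rewrite idealr1.
  have /existsNP[x /not_implyP[]] := sep _ ic.
  by rewrite mem_branch => /eqP xi /negP xR; exists x.
exists (\prod_i y i).
  by apply/negP => /spec_prod[i]; apply/negP; have [] := yP i.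
move=> x; rewrite mem_branch => /eqP xc; apply: ev_inj => i.
rewrite rmorphM; have [->|ic] := eqVneq i c; first by rewrite xc mulr0.
by rewrite (bigD1 i) //= rmorphM (yP i).2 // !mul0r.
Qed.

Lemma regular_generic_point :
  (Q : pred O) =i pred1 0 ->
  (forall i, i != c -> ~ {subset (branch i : pred A) <= (P : pred A)}) ->
  regular_point P.
Proof.
move=> Q0 sep; exists 0; split; first exact: krull_dim_generic_point.
apply: cotangent_dim0; elim/loc_ind=> a s; rewrite mem_loc_max mem_point Q0 inE.
have [y yP yE] := isolating_element sep => ac.
by apply/loc_frac_eq0; exists (Denom yP); apply: yE.
Qed.

Variable pi : O.
Hypothesis pi_neq0 : pi <> 0.
Hypothesis piQ : pi \in (Q : pred O).
Hypothesis pi_gen : forall x, x \in (Q : pred O) -> val_ge Q pi 1 x.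

Local Notation m := (loc_max_ideal P).

Lemma loc_of_pi_mem : loc_of P (cst pi) \in (m : pred (localization P)).
Proof. by rewrite mem_loc_max mem_point evK. Qed.

Definition pi_elt : ideal_elt m := IdealElt loc_of_pi_mem.

(** Evaluation at [c] sends [P] into [Q], so [P^2] into [Q^2]. *)
Lemma val_ge_sq (z : ideal_elt m) a s :
  z \in @ideal_sq _ m -> ielt z = loc_frac a s -> val_ge Q pi 2 (ev c a).
Proof.
move=> zsq zE.
have [||||||t tP] := @loc_max_sq _ P (fun b => val_ge Q pi 2 (ev c b)) _ _ _ _ z a s.
- by rewrite rmorph0; apply: val_ge_zero.
- by move=> b d; rewrite rmorphD; apply: val_geD.
- by move=> b d; rewrite rmorphM; apply: val_ge_mull.
- move=> b d bP dP; rewrite rmorphM.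
  by apply: (@val_geM _ _ _ 1 1); apply: pi_gen; rewrite -mem_point.
- by [].
- by [].
by rewrite rmorphM; apply: val_ge_cancel; rewrite -mem_point.
Qed.

Lemma pi_elt_nsq : pi_elt \notin @ideal_sq _ m.
Proof.
apply/negP => /val_ge_sq/(_ erefl); rewrite evK -[pi in val_ge _ _ _ pi]mul1r.
by apply: val_pi_lt2; rewrite ?idealr1.
Qed.

(** The maximal ideal is generated by [pi]: if [s' a(c) = pi b], the function
    [s' a - pi b] vanishes at [c], so it is zero in the local ring. *)
Lemma regular_closed_point :
  (forall i, i != c -> ~ {subset (branch i : pred A) <= (P : pred A)}) ->
  regular_point P.
Proof.
move=> sep; exists 1%N; split; first exact: krull_dim_closed_point pi_neq0 piQ.
apply: (@cotangent_dim1 _ _ pi_elt); last exact: pi_elt_nsq.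
  exact: loc_unit.
elim/loc_ind=> a s; rewrite mem_loc_max mem_point => /pi_gen[s' [b [s'Q]]].
rewrite expr1 => e; have [y yP yE] := isolating_element sep.
have s'P : cst s' \notin (P : pred A) by rewrite mem_point evK.
exists (loc_frac (cst b) (denomM (Denom s'P) s)).
rewrite [ielt _]/= loc_fracM; apply/loc_fracP; exists (Denom yP) => /=.
apply/eqP; rewrite -subr_eq0; apply/eqP.
transitivity (den s * (y * (cst s' * a - cst pi * cst b))); first by ring.
by rewrite yE ?mulr0 // mem_branch rmorphB !rmorphM !evK e subrr.
Qed.

Hypothesis val_finite : forall x, x <> 0 -> exists k, ~ val_ge Q pi k x.

(** The value at [d] of a function vanishing at [c] can be nonzero, as [delta d]
    shows, so there is a least valuation [k] of such values. *)
Lemma val_min_branch d : d != c -> exists k x,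
  [/\ forall y, y \in (branch c : pred A) -> val_ge Q pi k (ev d y),
      x \in (branch c : pred A) & ~ val_ge Q pi k.+1 (ev d x)].
Proof.
move=> dc; pose F k := `[< exists2 x, x \in (branch c : pred A) &
  ~ val_ge Q pi k (ev d x) >].
have exF : exists k, F k.
  have [k nk] := val_finite (@delta_diag d).
  by exists k; apply/asboolP; exists (delta d) => //; rewrite mem_branch delta_off.
case: (ex_minnP exF) => -[|k] /asboolP[x xc nx] kmin.
  by case: nx; apply: val_ge0.
exists k, x; split=> // y yc; apply: contrapT => ny.
suff /kmin : F k by rewrite ltnn.
by apply/asboolP; exists y.
Qed.

(** The elements [pi] and [x] of [val_min_branch] are independent modulo [m^2].
    The argument rests on the ideal of functions [a] in [P] such that
    [a(d) - a(c)] has valuation at least [k + 1].  It contains [P^2], since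
    [a(d) - a(c)] always has valuation at least [k] and
    [ab(d) - ab(c) = (a(d) - a(c)) b(d) + a(c) (b(d) - b(c))], but no multiple
    of [x] by a function outside [P]. *)
Lemma singular_crossing d :
  d != c -> {subset (branch d : pred A) <= (P : pred A)} -> singular_point P.
Proof.
move=> dc /branch_sub_point cong [n [[chn maxn]]].
have [ch1 max1] := krull_dim_closed_point pi_neq0 piQ.
have -> : n = 1%N by apply/eqP; rewrite eqn_leq max1 // maxn.
have [k [x [kmin xc nx]]] := val_min_branch dc.
have evdQ a : a \in (P : pred A) -> ev d a \in (Q : pred O).
  by rewrite mem_point => aP; have := cong a; rewrite rpredBl.
have diff a : val_ge Q pi k (ev d a - ev c a).
  by have := kmin _ (sub_cst_branch c a); rewrite rmorphB evK.
have xm : loc_of P x \in (m : pred (localization P)).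
  by rewrite mem_loc_max; apply: center_branch_sub.
have xnsq : IdealElt xm \notin @ideal_sq _ m.
  apply/negP => /(@loc_max_sq _ P (fun a => a \in (P : pred A) /\
    val_ge Q pi k.+1 (ev d a - ev c a))).
  case/(_ _ _ _ _ _ _ erefl).
  - by rewrite idealr0 !rmorph0 subrr; split=> //; apply: val_ge_zero.
  - move=> a b [aP va] [bP vb]; rewrite rpredD // !rmorphD; split=> //.
    rewrite (_ : _ - _ = (ev d a - ev c a) + (ev d b - ev c b)); last by ring.
    exact: val_geD.
  - move=> a b [bP vb]; rewrite idealMr // !rmorphM; split=> //.
    rewrite (_ : _ - _ = (ev d a - ev c a) * ev d b +
      ev c a * (ev d b - ev c b)); last by ring.
    apply: val_geD; last exact: val_ge_mull.
    by rewrite -addn1; apply: val_geM => //; apply/pi_gen/evdQ.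
  - move=> a b aP bP; rewrite idealMr // !rmorphM; split=> //.
    rewrite (_ : _ - _ = (ev d a - ev c a) * ev d b +
      (ev d b - ev c b) * ev c a); last by ring.
    by apply: val_geD; rewrite -addn1; apply: val_geM => //; apply: pi_gen;
      [apply: evdQ | rewrite -mem_point].
  move=> t tP [_]; move: xc; rewrite mem_branch !rmorphM => /eqP->.
  rewrite mulr0 subr0 => vt; apply: nx; apply: val_ge_cancel vt.
  by apply: contra tP => tdQ; rewrite mem_point -(subrK (ev d t) (ev c t)) rpredD.
(* Evaluating a relation between pi and x at c, where x vanishes, contradicts
   the fact that the coefficient b of pi is a unit. *)
move=> /cotangent_dim1_dep dep; have [a [b [bm]]] := dep pi_elt _ xnsq.
elim/loc_ind: a => a s; elim/loc_ind: b bm => b t; rewrite mem_loc_max => bP.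
move=> /val_ge_sq; rewrite ieltB /= !loc_fracM.
have -> : loc_frac (b * cst pi) (denomM t (denom1 P)) -
    loc_frac (a * x) (denomM s (denom1 P)) =
    loc_frac (b * cst pi * den s - a * x * den t) (denomM t s).
  have -> : - loc_frac (a * x) (denomM s (denom1 P)) =
      loc_frac (- (a * x)) (denomM s (denom1 P)) by exact: loc_oppE.
  by rewrite loc_fracD; apply/loc_fracP; exists (denom1 P); rewrite /=; ring.
move/(_ _ _ erefl); move: xc; rewrite mem_branch => /eqP xc.
rewrite rmorphB !rmorphM evK xc mulr0 mul0r subr0 mulrAC.
by apply: val_pi_lt2; rewrite // -rmorphM -mem_point prime_idealrM negb_or bP denP.
Qed.

End Curve.

(** * Arithmetic of cyclotomic integers *)

Section PrimePowerSum.
Variable A : comNzRingType.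

Lemma exprD_mod_prime p f (x y : A) : prime p ->
  exists w, (x + y) ^+ (p ^ f) = x ^+ (p ^ f) + y ^+ (p ^ f) + p%:R * w.
Proof.
move=> p_pr; have p_gt0 := prime_gt0 p_pr.
have step u v : exists w, (u + v) ^+ p = u ^+ p + v ^+ p + p%:R * w :> A.
  exists (\sum_(i < p.-1) u ^+ (p - i.+1) * v ^+ i.+1 *+ ('C(p, i.+1) %/ p)).
  rewrite exprDn; case: p p_pr p_gt0 => // p p_pr _.
  rewrite big_ord_recl big_ord_recr /= subn0 bin0 mulr1n expr0 mulr1.
  rewrite /bump /= add1n subnn expr0 mul1r binn mulr1n -addrA.
  congr (_ + _); rewrite addrC; congr (_ + _).
  rewrite mulr_sumr; apply: eq_bigr => i _; rewrite /bump /= add1n.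
  rewrite mulr_natl -mulrnA divnK //; apply: prime_dvd_bin => //.
  exact: (ltn_ord i).
elim: f => [|f [w IHf]]; first by exists 0; rewrite expn0 mulr0 addr0 !expr1.
rewrite expnSr !exprM IHf.
have [w1 ->] := step (x ^+ (p ^ f) + y ^+ (p ^ f)) (p%:R * w).
have [w2 ->] := step (x ^+ (p ^ f)) (y ^+ (p ^ f)).
exists (w2 + w1 + p%:R ^+ p.-1 * w ^+ p).
have -> : (p%:R * w) ^+ p = p%:R * (p%:R ^+ p.-1 * w ^+ p).
  by rewrite mulrA -exprS prednK // exprMn.
ring.
Qed.

End PrimePowerSum.

Section CyclotomicIntegers.
Variables (n : nat) (xi : algC).
Hypothesis xi_prim : n.-primitive_root xi.
Local Notation O := (Zxi xi).

Definition zeta : O := MkZxi (adjoin_int_gen xi).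

Lemma zxi_valD (x y : O) : zxi_val (x + y) = zxi_val x + zxi_val y.
Proof. exact: (rmorphD (val : O -> algC)). Qed.

Lemma zxi_valM (x y : O) : zxi_val (x * y) = zxi_val x * zxi_val y.
Proof. exact: (rmorphM (val : O -> algC)). Qed.

Lemma zxi_valX (x : O) k : zxi_val (x ^+ k) = zxi_val x ^+ k.
Proof. exact: (rmorphXn (val : O -> algC)). Qed.

Lemma zxi_val_nat k : zxi_val (k%:R : O) = k%:R.
Proof. exact: (rmorph_nat (val : O -> algC)). Qed.

Lemma zxi_val_eq0 (x : O) : zxi_val x = 0 -> x = 0.
Proof. by move=> x0; apply: val_inj; rewrite /= x0. Qed.

Lemma zxi_domain (x y : O) : x * y = 0 -> x = 0 \/ y = 0.
Proof.
move=> xy0; have := congr1 (@zxi_val xi) xy0; rewrite zxi_valM => /eqP.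
by rewrite mulf_eq0 => /orP[] /eqP/zxi_val_eq0; [left|right].
Qed.

Lemma zxi_nat_neq0 k : (0 < k)%N -> k%:R <> 0 :> O.
Proof.
move=> k_gt0 /(congr1 (@zxi_val xi)); rewrite zxi_val_nat => /eqP.
by rewrite pnatr_eq0 => /eqP k0; rewrite k0 in k_gt0.
Qed.

Lemma zeta_expn_eq1 k : (zeta ^+ k == 1) = (n %| k)%N.
Proof.
rewrite (prim_order_dvd xi_prim); apply/eqP/eqP => [/(congr1 (@zxi_val xi))|e].
  by rewrite zxi_valX.
by apply: val_inj; rewrite /= zxi_valX.
Qed.

(** Induction on elements of Z[xi], as a ring generated by [zeta]. *)
Lemma zxi_ind (S : O -> Prop) :
    S 1 -> S zeta -> (forall x y, S x -> S y -> S (x + y)) ->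
    (forall x, S x -> S (- x)) -> (forall x y, S x -> S y -> S (x * y)) ->
  forall x, S x.
Proof.
move=> S1 Sz SD SN SM.
have S0 : S 0 by rewrite -(subrr 1); apply: SD => //; apply: SN.
have Snat k : S k%:R by elim: k => // k IHk; rewrite -addn1 natrD; apply: SD.
have Sint (c : int) : S c%:~R.
  by case: c => k; [apply: Snat | rewrite NegzE mulrNz; apply: SN; apply: Snat].
have Spoly (p : {poly int}) :
    exists2 x, S x & zxi_val x = (map_poly intr p).[xi].
  elim/poly_ind: p => [|p c [x Sx xE]].
    by exists 0 => //; rewrite rmorph0 horner0.
  exists (x * zeta + c%:~R); first by apply: SD => //; apply: SM.
  rewrite zxi_valD zxi_valM xE rmorphD rmorphM /= map_polyX map_polyC !hornerE.
  by congr (_ + _); apply: (rmorph_int (val : O -> algC)).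
move=> x; have /asboolP[p pE] := zxi_valP x; have [y Sy yE] := Spoly p.
by rewrite (_ : x = y) //; apply: val_inj; rewrite /= pE yE.
Qed.

(** In an integral equation of [x], after division by powers of the variable, the
    constant term is a nonzero integer multiple of [x]. *)
Lemma int_poly_root_dvd_nat (q : {poly int}) (x : O) :
    q != 0 -> x <> 0 -> (map_poly intr q).[x] = 0 ->
  exists N y, (0 < N)%N /\ x * y = N%:R.
Proof.
elim/poly_ind: q => [|q c IHq]; first by rewrite eqxx.
move=> qc0 x0; rewrite rmorphD rmorphM /= map_polyX map_polyC !hornerE /=.
have [c0|c_neq0] := eqVneq c 0.
  move: qc0; rewrite c0 addr0 => q0.
  rewrite mulr0z addr0 => /zxi_domain[qx|/x0//].
  by apply: IHq => //; apply: contraNneq q0 => ->; rewrite mul0r.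
move=> e; exists `|c|%N, ((- 1) ^+ (0 <= c)%R * (map_poly intr q).[x]).
rewrite absz_gt0 c_neq0; split=> //.
have -> : (`|c|%N%:R : O) = (`|c| : int)%:~R by rewrite -abszE.
have qx : (map_poly intr q).[x] * x = - c%:~R by apply/eqP; rewrite -addr_eq0 e.
rewrite mulrCA [x * _]mulrC qx; case: ger0P => c_sgn.
  by rewrite expr1 mulN1r opprK.
by rewrite expr0 mul1r mulrNz.
Qed.

Lemma zxi_dvd_nat (x : O) : x <> 0 -> exists N y, (0 < N)%N /\ x * y = N%:R.
Proof.
move=> x0; have [p [p_min p_monic] _] := minCpolyP (zxi_val x).
have [q [a a_neq0 pE]] := rat_poly_scale p.
apply: (@int_poly_root_dvd_nat q) => //.
  apply: contraTneq p_monic => q0.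
  by rewrite pE q0 rmorph0 scaler0 monicE lead_coef0 eq_sym oner_eq0.
have: root (minCpoly (zxi_val x)) (zxi_val x) by apply: root_minCpoly.
rewrite p_min pE map_polyZ rootZ ?fmorph_eq0 ?invr_eq0 ?intr_eq0 // => /eqP qx.
apply: zxi_val_eq0; rewrite -qx.
transitivity (map_poly (val : O -> algC) (map_poly intr q)).[zxi_val x].
  by rewrite horner_map.
rewrite -!map_poly_comp.
congr (_.[_]); apply: eq_map_poly => c /=.
by rewrite ratr_int; apply: (rmorph_int (val : O -> algC)).
Qed.

(** A prime factor of [N] lies in [Q], or else the cofactor does. *)
Lemma spec_nat_prime (Q : spec O) N : (0 < N)%N -> N%:R \in (Q : pred O) ->
  exists2 p, prime p & p%:R \in (Q : pred O).
Proof.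
elim/ltn_ind: N => N IHN N_gt0 NQ.
have N_gt1 : (1 < N)%N.
  by case: N N_gt0 NQ {IHN} => [|[|N]] //; rewrite idealr1.
have [pQ|pQ] := boolP ((pdiv N)%:R \in (Q : pred O)).
  by exists (pdiv N); first exact: pdiv_prime.
apply: (IHN (N %/ pdiv N)%N).
- by rewrite ltn_Pdiv // prime_gt1 // pdiv_prime.
- by rewrite divn_gt0 ?pdiv_gt0 // dvdn_leq // pdiv_dvd.
by move: NQ; rewrite -{1}(divnK (pdiv_dvd N)) natrM prime_idealrM (negPf pQ) orbF.
Qed.

Lemma spec_nonzero_prime (Q : spec O) x : x <> 0 -> x \in (Q : pred O) ->
  exists2 p, prime p & p%:R \in (Q : pred O).
Proof.
move=> /zxi_dvd_nat[N [y [N_gt0 xyE]]] xQ.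
by apply: (spec_nat_prime N_gt0); rewrite -xyE spec_mulr.
Qed.

Lemma spec_coprime_nat (Q : spec O) p u :
  p%:R \in (Q : pred O) -> coprime p u -> u%:R \notin (Q : pred O).
Proof.
move=> pQ cpu; apply/negP => uQ.
have [p0|p_gt0] := posnP p.
  by move: cpu uQ; rewrite p0 /coprime gcd0n => /eqP->; rewrite idealr1.
have [a _] := Bezoutl u p_gt0.
rewrite (eqP cpu) => /dvdnP[b e].
have: (1 + a * u)%:R \in (Q : pred O) by rewrite e natrM idealMr.
by rewrite natrD natrM rpredDr ?idealr1 // idealMr.
Qed.

Lemma one_sub_exp_dvd (t : O) k : exists w, 1 - t ^+ k = (1 - t) * w.
Proof.
exists (\sum_(i < k) t ^+ i); rewrite -[LHS]opprB subrX1.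
by rewrite -mulNr opprB.
Qed.

(** For [n = m * p ^ a] take [pi = p] if [a = 0] and [pi = 1 - t] with
    [t = zeta ^+ m] otherwise.  In the latter case [y = t ^+ p ^ a.-1] is a
    primitive p-th root of unity, so the sum of its powers vanishes, while each
    power is 1 modulo [pi]; hence [pi] divides [p].  Conversely [p] divides
    [(1 - t) ^+ p ^ a]: raise [1 = (1 - t) + t] to this power modulo [p] and use
    [t ^+ p ^ a = 1]. *)
Lemma cyclotomic_parameter p (m := (n %/ p ^ logn p n)%N) : prime p ->
  exists pi : O, [/\ pi <> 0, exists w, p%:R = pi * w,
    exists w, 1 - zeta ^+ m = pi * w & exists E w, pi ^+ E = p%:R * w].
Proof.
move=> p_pr; have n_gt0 := prim_order_gt0 xi_prim.
have nE : n = (m * p ^ logn p n)%N by rewrite divnK // pfactor_dvdnn.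
have m_gt0 : (0 < m)%N by move: n_gt0; rewrite {1}nE muln_gt0 => /andP[].
case aE : (logn p n) => [|a] in nE *.
  exists p%:R; split.
  - exact/zxi_nat_neq0/prime_gt0.
  - by exists 1; rewrite mulr1.
  - exists 0; rewrite mulr0; apply/eqP; rewrite subr_eq0 eq_sym zeta_expn_eq1.
    by rewrite {1}nE muln1.
  - by exists 1%N, 1; rewrite mulr1.
have p_gt1 := prime_gt1 p_pr.
have pow_neq1 b : (b <= a)%N -> zeta ^+ (m * p ^ b) <> 1.
  move=> ba /eqP; rewrite zeta_expn_eq1 => /dvdn_leq.
  rewrite muln_gt0 m_gt0 expn_gt0 prime_gt0 // => /(_ isT).
  by rewrite {1}nE leq_pmul2l // leq_exp2l // leqNgt ltnS ba.
set t := zeta ^+ m; exists (1 - t); split.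
- move=> /eqP; rewrite subr_eq0 eq_sym => /eqP.
  by have := @pow_neq1 0 (leq0n _); rewrite expn0 muln1.
- pose y := t ^+ (p ^ a).
  have yE : y = zeta ^+ (m * p ^ a) by rewrite exprM.
  have sum0 : \sum_(i < p) y ^+ i = 0.
    have: (y - 1) * \sum_(i < p) y ^+ i = 0.
      rewrite -subrX1 -exprM -exprM mulnC -expnSr mulnC -nE.
      by apply/eqP; rewrite subr_eq0 zeta_expn_eq1.
    by case/zxi_domain => // /eqP; rewrite subr_eq0 yE => /eqP/(pow_neq1 _ (leqnn a)).
  have [w wE] := choice (fun i : 'I_p => one_sub_exp_dvd t (p ^ a * i)).
  exists (\sum_i w i); rewrite mulr_sumr.
  under eq_bigr => i _ do rewrite -wE exprM.
  by rewrite sumrB sum0 subr0 sumr_const card_ord.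
- by exists 1; rewrite mulr1.
exists (p ^ a.+1)%N; have [w] := exprD_mod_prime a.+1 (1 - t) t p_pr.
rewrite subrK expr1n -[t ^+ _]exprM -nE.
have /eqP -> : zeta ^+ n == 1 by rewrite zeta_expn_eq1.
move=> e; exists (- w); apply/eqP; rewrite mulrN -subr_eq0 opprK.
by apply/eqP; apply: (addrI 1); rewrite addr0 [RHS]e; ring.
Qed.

(** Since [pi] divides [p], the elements fixed by the q-th power modulo [pi] form a
    subring.  It contains [zeta] as [q - 1] is a multiple of [m] by Euler's
    theorem and [zeta ^+ m = 1] modulo [pi]. *)
Lemma uniformizer_exists p : prime p ->
  exists (pi : O) (q : nat), [/\ pi <> 0, exists E w, pi ^+ E = p%:R * w,
    (1 < q)%N & forall x, exists w, x ^+ q - x = pi * w].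
Proof.
move=> p_pr; have n_gt0 := prim_order_gt0 xi_prim.
have [pi [pi0 [p' pE] [z' zE] piE]] := cyclotomic_parameter p_pr.
set m := (n %/ p ^ logn p n)%N in zE.
have cpm : coprime p m.
  have [m' cpm' nE] := pfactor_coprime p_pr n_gt0.
  by rewrite /m [X in (X %/ _)%N]nE mulnK // expn_gt0 prime_gt0.
have m_gt0 : (0 < m)%N.
  by rewrite divn_gt0 ?expn_gt0 ?prime_gt0 // dvdn_leq // pfactor_dvdnn.
pose f := totient m; pose q := (p ^ f)%N.
have q_gt1 : (1 < q)%N by rewrite -(exp1n f) ltn_exp2r ?totient_gt0 ?prime_gt1.
exists pi, q; split=> //.
have SD x y : (exists w, x ^+ q - x = pi * w) -> (exists w, y ^+ q - y = pi * w) ->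
    exists w, (x + y) ^+ q - (x + y) = pi * w.
  move=> [u ux] [v vy]; have [w ->] := exprD_mod_prime f x y p_pr.
  exists (u + v + p' * w); rewrite !mulrDr -ux -vy mulrA -pE; ring.
have Sp y : exists w, (p%:R * y) ^+ q - p%:R * y = pi * w.
  exists (p' * y * ((p%:R * y) ^+ q.-1 - 1)).
  by rewrite -{1}(prednK (ltnW q_gt1)) exprS !mulrA -pE; ring.
have Snat x k : (exists w, x ^+ q - x = pi * w) ->
    exists w, (k%:R * x) ^+ q - k%:R * x = pi * w.
  move=> Sx; elim: k => [|k IHk].
    by exists 0; rewrite mul0r subr0 expr0n -(prednK (ltnW q_gt1)) mulr0.
  by rewrite -addn1 natrD mulrDl mul1r; apply: SD.
apply: zxi_ind => // [||x Sx|x y [u ux] [v vy]].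
- by exists 0; rewrite expr1n subrr mulr0.
- have /dvdnP[k kE] : (m %| q.-1)%N.
    rewrite -subn1 -eqn_mod_dvd; last exact: ltnW.
    by rewrite Euler_exp_totient.
  have [w wE] := one_sub_exp_dvd (zeta ^+ m) k.
  exists (- zeta * z' * w).
  rewrite -(prednK (ltnW q_gt1)) exprS kE mulnC exprM.
  transitivity (- zeta * (1 - zeta ^+ m ^+ k)); first by ring.
  by rewrite wE zE; ring.
- have -> : - x = p.-1%:R * x + p%:R * (- x).
    by rewrite -{2}(prednK (prime_gt0 p_pr)) -addn1 natrD; ring.
  by apply: SD => //; apply: Snat.
- exists (x ^+ q * v + u * y); rewrite mulrDr mulrCA -vy mulrA -ux exprMn; ring.
Qed.

Section AtPrime.
Variables (Q : spec O) (p : nat).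
Hypothesis p_pr : prime p.
Hypothesis pQ : p%:R \in (Q : pred O).

Lemma uniformizer_mem (pi : O) : (exists E w, pi ^+ E = p%:R * w) ->
  pi \in (Q : pred O).
Proof. by case=> E [w e]; apply: (@spec_exp _ _ _ E); rewrite e spec_mulr. Qed.

Lemma exp_sub1_notin x k : (0 < k)%N -> x \in (Q : pred O) ->
  1 - x ^+ k \notin (Q : pred O).
Proof.
case: k => // k _ xQ; apply/negP => h; have := idealr1 (Q : idealr O).
by rewrite -(subrK (x ^+ k.+1) 1) rpredD // exprS spec_mulr.
Qed.

(** Finiteness of the valuation reduces to that of integers: as [p] divides
    [pi ^+ E], a natural number [p ^ v * u] with [u] prime to [p] is not
    divisible by [pi ^+ (E * v + 1)]. *)
Lemma zxi_dvr : exists pi : O, [/\ pi <> 0, pi \in (Q : pred O),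
  forall x, x \in (Q : pred O) -> val_ge Q pi 1 x &
  forall x, x <> 0 -> exists k, ~ val_ge Q pi k x].
Proof.
have [pi [q [pi0 piE q_gt1 qE]]] := uniformizer_exists p_pr.
have piQ := uniformizer_mem piE.
exists pi; split=> // x.
  move=> xQ; have [w wE] := qE x; exists (1 - x ^+ q.-1), (- w); split.
    by rewrite exp_sub1_notin // -subn1 subn_gt0.
  rewrite mulrN -wE -{2}(prednK (ltnW q_gt1)) exprSr; ring.
move=> /zxi_dvd_nat[N [y [N_gt0 xyE]]].
have [u cpu NE] := pfactor_coprime p_pr N_gt0.
have [E [w piEw]] := piE; set v := logn p N in NE.
exists (E * v).+1 => -[s [b [sQ e]]].
have pv0 : p%:R ^+ v <> 0 :> O.
  by rewrite -natrX; apply: zxi_nat_neq0; rewrite expn_gt0 prime_gt0.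
have: p%:R ^+ v * (s * u%:R - w ^+ v * pi * b * y) = 0.
  have : s * x * y = pi ^+ (E * v).+1 * b * y by rewrite e.
  rewrite -mulrA xyE NE natrM natrX exprS exprM piEw exprMn => h.
  by apply/eqP; rewrite mulrBr subr_eq0; apply/eqP; move: h => /= h;
    transitivity (s * (u%:R * p%:R ^+ v)); [ring | rewrite h; ring].
case/zxi_domain => // /eqP; rewrite subr_eq0 => /eqP suE.
have: s * u%:R \in (Q : pred O) by rewrite suE -!mulrA idealMr // spec_mulr.
by rewrite prime_idealrM (negPf sQ) (negPf (spec_coprime_nat pQ cpu)).
Qed.

End AtPrime.

(** Let [p] be the prime number in [Q1] and [y] an element of [Q2].  The multiple
    [y * (1 - y ^+ q.-1)] of [pi] lies in [Q1], but its second factor is not even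
    in [Q2]. *)
Lemma zxi_nonzero_prime_max (Q1 Q2 : spec O) x :
  x <> 0 -> x \in (Q1 : pred O) -> {subset (Q1 : pred O) <= (Q2 : pred O)} ->
  {subset (Q2 : pred O) <= (Q1 : pred O)}.
Proof.
move=> x0 xQ1 Q12 y yQ2; have [p p_pr pQ1] := spec_nonzero_prime x0 xQ1.
have [pi [q [_ piE q_gt1 qE]]] := uniformizer_exists p_pr.
have [w wE] := qE y.
have: y * (1 - y ^+ q.-1) \in (Q1 : pred O).
  have -> : y * (1 - y ^+ q.-1) = pi * (- w).
    by rewrite mulrN -wE -{2}(prednK (ltnW q_gt1)) exprS; ring.
  by rewrite spec_mulr // (uniformizer_mem pQ1).
rewrite prime_idealrM => /orP[//|/Q12].
by rewrite (negPf (exp_sub1_notin _ yQ2)) // -subn1 subn_gt0.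
Qed.

Lemma has_char_prime (Q : spec O) p x :
    has_char {ideal_quot (Q : idealr O)} p -> x <> 0 -> x \in (Q : pred O) ->
  prime p /\ p%:R \in (Q : pred O).
Proof.
move=> chQ x0 xQ.
have memQ k : (k%:R \in (Q : pred O)) = (p %| k)%N.
  by rewrite -chQ -(rmorph_nat (\pi_{ideal_quot (Q : idealr O)})%qT) pi_ideal_eq0.
have [p0 p0_pr] := spec_nonzero_prime x0 xQ.
rewrite memQ => pp0.
have /primeP[_ /(_ p pp0)/orP[/eqP p1|/eqP pE]] := p0_pr.
  by have := memQ 1%N; rewrite p1 idealr1 dvdnn.
by rewrite memQ dvdnn pE.
Qed.

End CyclotomicIntegers.

(** * Congruences between character values *)

Section CharacterValues.
Variables (gT : finGroupType) (G : {group gT}) (xi : algC).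
Hypothesis xi_prim : #|G|.-primitive_root xi.
Local Notation O := (Zxi xi).
Local Notation R := (Rbar G xi).

Lemma sub_char_adjoin_int (H : {group gT}) (phi : 'CF(H)) x :
  H \subset G -> phi \is a character -> phi x \in adjoin_int xi.
Proof.
move=> sHG phi_char; have dvHG := cardSg sHG.
have := char_adjoin_int (dvdn_prim_root xi_prim dvHG) x phi_char.
case/asboolP=> q ->; rewrite horner_coef; apply: rpred_sum => i _.
rewrite coef_map rpredM ?rpred_int // -exprM rpredX //.
exact: adjoin_int_gen.
Qed.

Lemma irr_conj_adjoin_int (H : {group gT}) (i : Iirr H) x :
  H \subset G -> ('chi_i x)^* \in adjoin_int xi.
Proof.
by move=> sHG; rewrite -irr_inv sub_char_adjoin_int // irr_char.
Qed.

(** By orthogonality, this is the characteristic function of the class of [x] in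
    [H] times the order of the centralizer of [x] ([class_sum_cfunE]); the factor
    makes the coefficients on the irreducible characters lie in Z[xi]. *)
Definition class_sum_cfun (H : {group gT}) (x : gT) : 'CF(H) :=
  \sum_i ('chi_i x)^* *: 'chi_i.

Lemma class_sum_cfunE (H : {group gT}) x y : x \in H ->
  class_sum_cfun H x y = #|'C_H[y]%g|%:R *+ (y \in x ^: H)%g.
Proof.
move=> Hx; rewrite -second_orthogonality_relation // sum_cfunE.
by apply: eq_bigr => i _; rewrite cfunE mulrC.
Qed.

Definition rbar_at (g : gT) (phi : R) : O := MkZxi (rbar_adjoin_int xi_prim phi g).

Section Congruence.
Variables (Q : spec O) (p : nat).
Hypothesis p_pr : prime p.
Hypothesis pQ : p%:R \in (Q : pred O).

(** Membership in [Q] for complex numbers, so that class functions can be handled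
    without proofs that their values lie in Z[xi]. *)
Definition zero_mod (z : algC) : Prop :=
  exists2 w : O, w \in (Q : pred O) & zxi_val w = z.

Lemma zero_mod_sum (J : finType) (F : J -> algC) :
  (forall j, zero_mod (F j)) -> zero_mod (\sum_j F j).
Proof.
move=> F0; elim/big_ind: _ => [|u v [a aQ <-] [b bQ <-]|//].
  by exists 0; rewrite ?idealr0.
by exists (a + b); rewrite ?rpredD // zxi_valD.
Qed.

Lemma zero_mod_mull a z : a \in adjoin_int xi -> zero_mod z -> zero_mod (a * z).
Proof.
move=> aO [w wQ <-]; exists (MkZxi aO * w); first by rewrite idealMr.
by rewrite zxi_valM.
Qed.

Lemma expg_p'part_order (g : gT) : (g ^+ #[g.`_p] = g.`_p^' ^+ #[g.`_p])%g.
Proof.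
rewrite -{1}(consttC p g) expgMn; last first.
  exact: (centsP (cycle_abelian g)) (cycle_constt _ _) _ (cycle_constt _ _).
by rewrite expg_order mul1g.
Qed.

(** With [p ^ a] the order of the p-part of [g], the values [u] and [v] of [lam] at
    [g] and at its p-regular part have the same power of exponent [p ^ a], so
    [(u - v) ^+ (p ^ a)] is a multiple of [p]. *)
Lemma lin_char_cong (g : gT) (lam : 'CF(<[g]>)) :
  g \in G -> lam \is a linear_char -> zero_mod (lam g - lam (g.`_p^')%g).
Proof.
move=> Gg lin_lam; have sgG : <[g]>%g \subset G by rewrite cycle_subG.
have adj x := sub_char_adjoin_int x sgG (lin_charW lin_lam).
pose u := MkZxi (adj g); pose v := MkZxi (adj (g.`_p^')%g).
exists (u - v); last exact: (rmorphB (val : O -> algC)).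
have /p_natP[a aE] : p.-nat #[g.`_p]%g by rewrite order_constt part_pnat.
apply: (@spec_exp _ _ _ (p ^ a)); have [w] := exprD_mod_prime a (u - v) v p_pr.
have -> : u - v + v = u by rewrite subrK.
have -> : u ^+ (p ^ a) = v ^+ (p ^ a).
  apply: val_inj; rewrite /= !zxi_valX /= -!lin_charX ?cycle_id ?cycle_constt //.
  by rewrite -aE expg_p'part_order.
move=> e; have -> : (u - v) ^+ (p ^ a) = p%:R * - w.
  by apply: (addIr (v ^+ (p ^ a))); rewrite [in RHS]e; ring.
exact: spec_mulr.
Qed.

(** The restriction to the cyclic group generated by [g] is a sum of linear
    characters. *)
Lemma char_cong (g : gT) (chi : 'CF(G)) :
  g \in G -> chi \is a character -> zero_mod (chi g - chi (g.`_p^')%g).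
Proof.
move=> Gg chi_char; have sgG : <[g]>%g \subset G by rewrite cycle_subG.
rewrite -(cfResE chi sgG (cycle_id g)) -(cfResE chi sgG (cycle_constt _ _)).
have res_char := cfRes_char <[g]>%G chi_char.
rewrite (cfun_sum_cfdot (cfRes <[g]>%g chi)) !sum_cfunE.
rewrite -sumrB; apply: zero_mod_sum => i; rewrite !cfunE -mulrBr.
apply: zero_mod_mull; last first.
  by apply: lin_char_cong => //; apply: char_abelianP; apply: cycle_abelian.
by have /natrP[k ->] := Cnat_cfdot_char_irr i res_char; apply: rpred_nat.
Qed.

Lemma rbar_cong (g : gT) (phi : R) :
  g \in G -> rbar_at g phi - rbar_at (g.`_p^')%g phi \in (Q : pred O).
Proof.
move=> Gg; have [a aO phiE] := rbarP _ _ (rbar_valP phi).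
have [w wQ wE] : zero_mod (rbar_val phi g - rbar_val phi (g.`_p^')%g).
  rewrite phiE !sum_cfunE -sumrB; apply: zero_mod_sum => i.
  rewrite !cfunE -mulrBr; apply: zero_mod_mull => //.
  exact/char_cong/irr_char.
suff -> : rbar_at g phi - rbar_at (g.`_p^')%g phi = w by [].
by apply: val_inj; rewrite /= wE.
Qed.

End Congruence.

Section Separation.
Variables (p : nat) (g : gT).
Hypothesis p_pr : prime p.
Hypothesis Gg : g \in G.
Hypothesis p'g : (p^'.-elt g)%g.

(** Let [S] be a Sylow p-subgroup of the centralizer of [g] and let [theta] on
    [<[g]> \x S] be supported on the coset of [S] through [g], with value [#[g]]
    there.  The only p-regular element of this coset is [g], so the induced
    function vanishes at the p-regular elements that are not conjugate to [g],
    and at [g] its value is the index of [S] in the centralizer. *)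
Lemma p'_separating : exists (phi : R) (N : nat), [/\ coprime p N,
  rbar_val phi g = N%:R & forall x, x \in G -> (p^'.-elt x)%g ->
    (x \notin g ^: G)%g -> rbar_val phi x = 0].
Proof.
have [S sylS] := Sylow_exists p ('C_G[g])%G.
have [sSC pS _] := and3P sylS.
have sSG : S \subset G by rewrite (fintype.subset_trans sSC) ?finset.subsetIl.
have cgS : S \subset 'C(<[g]>)%g.
  by rewrite cent_cycle (fintype.subset_trans sSC) ?finset.subsetIr.
have tiS : (<[g]> :&: S = 1)%g.
  by apply: coprime_TIg; rewrite coprime_sym; apply: (pnat_coprime pS).
have KxS : (<[g]> \x S = <[g]> <*> S)%g by apply: dprodEY.
set H := (<[g]> <*> S)%G in KxS.
have sHG : H \subset G by rewrite join_subG cycle_subG Gg.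
pose f : 'CF(<[g]>) := class_sum_cfun <[g]>%G g.
have fE y : y \in <[g]>%g -> f y = #[g]%g%:R *+ (y == g).
  have abK := cycle_abelian g; move=> Ky.
  rewrite class_sum_cfunE ?cycle_id // (abelian_classP _ abK) ?cycle_id // inE.
  by rewrite (finset.setIidPl _) // sub_cent1 (fintype.subsetP abK).
pose theta := cfDprodl KxS f.
have thetaE x : (p^'.-elt x)%g -> theta x = #[g]%g%:R *+ (x == g).
  move=> p'x; have [->|x_neq] := eqVneq x g.
    have := cfDprodEl KxS f (cycle_id g) (group1 S).
    by rewrite mulg1 fE ?cycle_id // eqxx.
  have [Hx|/cfun0//] := boolP (x \in H).
  have [h [s [Kh Ss xE _]]] := mem_dprod KxS Hx.
  rewrite xE cfDprodEl // fE //; case: eqP => // hg; case/eqP: x_neq.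
  (* x and g are the p-regular parts of g s and g, hence equal. *)
  rewrite -(constt_p_elt p'x) xE hg consttM; last first.
    by apply: commute_sym; apply: (centsP cgS) => //; apply: cycle_id.
  rewrite (constt_p_elt p'g) (constt1P _) ?mulg1 //.
  by rewrite /p_elt pnatNK; apply: mem_p_elt Ss.
have phi_rbar : 'Ind[G] theta \in @rbar _ G xi.
  rewrite /theta /f /class_sum_cfun !linear_sum rpred_sum // => i _.
  rewrite !linearZ rbar_scale ?irr_conj_adjoin_int ?cycle_subG //.
  by apply: rbar_char; rewrite cfInd_char // cfDprodl_char irr_char.
have phiE x : x \in G -> (p^'.-elt x)%g -> 'Ind[G] theta x =
    #|H|%:R^-1 * \sum_(y in G) #[g]%g%:R *+ (x ^ y == g)%g.
  move=> Gx p'x; rewrite cfIndE //; congr (_ * _); apply: eq_bigr => y Gy.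
  by rewrite thetaE // p_eltJ.
exists (MkRbar phi_rbar), #|'C_G[g] : S|%g; split.
- by have /and3P[_ _] := sylS; rewrite p'natE // prime_coprime.
- rewrite /= phiE // -(dprod_card KxS) -/(#[g]%g).
  have -> : \sum_(y in G) #[g]%g%:R *+ (g ^ y == g)%g =
      (#[g]%g * #|'C_G[g]%g|)%:R :> algC.
    rewrite (bigID (fun y => g ^ y == g)%g) /= [X in _ + X]big1 ?addr0; last first.
      by move=> y /andP[_ /negPf->].
    rewrite (eq_bigr (fun _ => #[g]%g%:R)); last by move=> y /andP[_ ->].
    rewrite sumr_const natrM mulr_natr; congr (_ *+ _); apply: eq_card => y.
    by rewrite !inE conjg_set1 finset.sub1set inE.
  have <- : (#|S| * #|'C_G[g] : S|%g)%N = #|'C_G[g]%g| := Lagrange sSC.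
  rewrite mulnA [X in _ * X]natrM mulKf // pnatr_eq0 -lt0n.
  by rewrite muln_gt0 order_gt0 cardG_gt0.
move=> x Gx p'x ngx; rewrite /= phiE // big1 ?mulr0 // => y Gy.
case: eqP => // xyg; case/negP: ngx; rewrite -xyg class_sym.
exact: memJ_class.
Qed.

End Separation.

End CharacterValues.

(** * Branches of the spectrum of the representation ring *)

Section RepresentationRing.
Variables (gT : finGroupType) (G : {group gT}) (xi : algC).
Hypothesis xi_prim : #|G|.-primitive_root xi.
Local Notation O := (Zxi xi).
Local Notation R := (Rbar G xi).

Definition scalar_rbar (z : O) : R :=
  MkRbar (rbar_scale (zxi_valP z) (rpred1 (@rbar _ G xi))).

Lemma scalar_rbar_zmod_morphism : zmod_morphism scalar_rbar.
Proof.
by move=> u v; apply: val_inj; rewrite /= -scalerBl; congr (_ *: _);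
   apply: (rmorphB (val : O -> algC)).
Qed.

Lemma scalar_rbar_monoid_morphism : monoid_morphism scalar_rbar.
Proof.
split=> [|u v]; apply: val_inj; rewrite /= ?scale1r //.
by rewrite -scalerAl mul1r scalerA; congr (_ *: _); apply: zxi_valM.
Qed.

HB.instance Definition _ := GRing.isZmodMorphism.Build O R scalar_rbar
  scalar_rbar_zmod_morphism.
HB.instance Definition _ := GRing.isMonoidMorphism.Build O R scalar_rbar
  scalar_rbar_monoid_morphism.

Lemma Cl_repr (c : Cl G) :
  fingroup.repr (sval c) \in G /\ sval c = (fingroup.repr (sval c) ^: G)%g.
Proof.
have /imsetP[x Gx ->] := svalP c; have [y Gy ->] := repr_class G x.
by rewrite groupJ // classGidl.
Qed.

Lemma Cl_eq_repr (c d : Cl G) :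
  (fingroup.repr (sval c) \in fingroup.repr (sval d) ^: G)%g -> c = d.
Proof.
have [_ cE] := Cl_repr c; have [_ dE] := Cl_repr d.
by move=> /class_eqP cd; apply: val_inj; rewrite /= cE dE cd.
Qed.

Lemma class_eval_at (c : Cl G) (phi : R) :
  class_eval xi_prim c phi = rbar_at xi_prim (fingroup.repr (sval c)) phi.
Proof. by []. Qed.

Lemma class_evalK (c : Cl G) z : class_eval xi_prim c (scalar_rbar z) = z.
Proof.
by apply: val_inj; rewrite /= cfunE cfun1E (Cl_repr c).1 mulr1.
Qed.

Lemma class_eval_inj (phi : R) :
  (forall c : Cl G, class_eval xi_prim c phi = 0) -> phi = 0.
Proof.
move=> phi0; apply: val_inj; apply/cfun_inP => x Gx; rewrite cfunE.
have := congr1 (@zxi_val xi) (phi0 (exist _ (x ^: G)%g (mem_classes Gx))).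
by rewrite /=; have [y Gy ->] := repr_class G x; rewrite cfunJ.
Qed.

Lemma class_sum_rbar (c : Cl G) :
  class_sum_cfun G (fingroup.repr (sval c)) \in @rbar _ G xi.
Proof.
apply: rpred_sum => i _; apply: rbar_scale; last exact/rbar_char/irr_char.
exact: (irr_conj_adjoin_int xi_prim _ _ (fintype.subxx _)).
Qed.

Definition class_sum (c : Cl G) : R := MkRbar (class_sum_rbar c).

Lemma class_sum_diag (c : Cl G) : class_eval xi_prim c (class_sum c) <> 0.
Proof.
move=> /(congr1 (@zxi_val xi)); rewrite /= class_sum_cfunE ?(Cl_repr c).1 //.
rewrite class_refl; apply/eqP; rewrite pnatr_eq0 -lt0n; exact: cardG_gt0.
Qed.

Lemma class_sum_off (c d : Cl G) :
  c != d -> class_eval xi_prim d (class_sum c) = 0.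
Proof.
move=> cd; apply: val_inj; rewrite /= class_sum_cfunE ?(Cl_repr c).1 //.
by case: (boolP (_ \in _)) => // /Cl_eq_repr dc; rewrite dc eqxx in cd.
Qed.

Lemma reg_class_repr (p : nat) (c : Cl G) :
  reg_class p c = ((fingroup.repr (sval c)).`_p^' ^: G)%g.
Proof.
have [Gx cE] := Cl_repr c; rewrite /reg_class {1}cE.
move: (fingroup.repr _) Gx => x Gx; apply/setP => y.
apply/imsetP/imsetP => [[_ /imsetP[z Gz ->] ->]|[z Gz ->]].
  by exists z; rewrite ?consttJ.
by exists (x ^ z)%g; rewrite ?consttJ ?memJ_class.
Qed.

(** Both sides depend only on p-regular parts: phi(c) and phi(d) are congruent to
    the values at the p-regular parts, which [p'_separating] tells apart when
    these are not conjugate. *)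
Lemma class_cong_iff (Q : spec O) p (c d : Cl G) :
    prime p -> p%:R \in (Q : pred O) ->
  (forall phi : R, class_eval xi_prim c phi - class_eval xi_prim d phi
     \in (Q : pred O)) <-> reg_class p c = reg_class p d.
Proof.
move=> p_pr pQ; rewrite !reg_class_repr.
have [[Gx _] [Gy _]] := (Cl_repr c, Cl_repr d).
pose ev := rbar_at xi_prim.
set x := fingroup.repr (sval c) in Gx *; set y := fingroup.repr (sval d) in Gy *.
have congx phi : ev x phi - ev (x.`_p^')%g phi \in (Q : pred O).
  exact: rbar_cong.
have congy phi : ev y phi - ev (y.`_p^')%g phi \in (Q : pred O).
  exact: rbar_cong.
have Gp' z : z \in G -> (z.`_p^')%g \in G by apply: groupX.
have p'x (z : gT) : (p^'.-elt z.`_p^')%g by apply: p_elt_constt.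
split=> [cong|xy phi].
  apply/eqP; rewrite eq_sym; apply/eqP/class_eqP; apply: contraT => nyx.
  have [phi [N [cpN phix phiy]]] := p'_separating xi_prim p_pr (Gp' x Gx) (p'x x).
  have evx : ev (x.`_p^')%g phi = N%:R.
    by apply: val_inj; rewrite /= phix zxi_val_nat.
  have evy : ev (y.`_p^')%g phi = 0.
    by apply: val_inj; rewrite /= phiy // Gp'.
  have := cong phi; rewrite !class_eval_at -/x -/y -/(ev x phi) -/(ev y phi) => h.
  have := spec_coprime_nat pQ cpN; rewrite -evx => /negP[].
  have -> : ev (x.`_p^')%g phi = ev x phi - ev y phi -
      (ev x phi - ev (x.`_p^')%g phi) + (ev y phi - ev (y.`_p^')%g phi).
    by rewrite evy; ring.
  by rewrite rpredD // rpredB.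
rewrite !class_eval_at -/x -/y -/(ev x phi) -/(ev y phi).
have evxy : ev (x.`_p^')%g phi = ev (y.`_p^')%g phi.
  apply: val_inj => /=; have /imsetP[z Gz ->] : (x.`_p^' \in y.`_p^' ^: G)%g.
    by rewrite -xy class_refl.
  by rewrite cfunJ.
have -> : ev x phi - ev y phi = (ev x phi - ev (x.`_p^')%g phi) -
    (ev y phi - ev (y.`_p^')%g phi) by rewrite evxy; ring.
exact: rpredB.
Qed.

Section Branches.

Let ev (c : Cl G) : {rmorphism R -> O} := class_eval xi_prim c.
Let dom := @zxi_domain xi.

Lemma in_two_components_classP (Q : spec O) (c : Cl G) :
  in_two_components (class_point xi_prim c Q) <-> exists2 d : Cl G, d != c &
    {subset (branch ev dom d : pred R) <= (class_point xi_prim c Q : pred R)}.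
Proof.
rewrite (in_two_componentsP (branch_below dom class_eval_inj)
  (branch_incomparable class_sum_diag class_sum_off)).
split=> [[d [e [de dP eP]]]|[d dc dP]].
  have [dc|dc] := eqVneq d c; last by exists d.
  by exists e => //; rewrite -dc eq_sym.
by exists d, c; split=> //; apply: center_branch_sub class_evalK _ _.
Qed.

End Branches.

End RepresentationRing.

(** * Singular points *)

Theorem proposition3p5 (gT : finGroupType) (G : {group gT}) (xi : algC)
    (xi_prim : #|G|.-primitive_root xi)
    (Q : spec (Zxi xi)) (c : Cl G) (p : nat)
    (charQ : has_char {ideal_quot (Q : idealr (Zxi xi))} p) :
  let P := class_point xi_prim c Q in
  [<-> singular_point P;
       in_two_components P;
       ~ ((Q : pred (Zxi xi)) =i pred1 0) /\
       exists2 d : Cl G, d != c &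
         reg_class p c = reg_class p d]
  /\ (~~ (p %| #|G|)%N -> ~ singular_point P).
Proof.
move=> P.
pose ev (d : Cl G) : {rmorphism Rbar G xi -> Zxi xi} := class_eval xi_prim d.
pose cst : {rmorphism Zxi xi -> Rbar G xi} := @scalar_rbar _ G xi.
pose dom := @zxi_domain xi.
have evK d z : ev d (cst z) = z by apply: class_evalK.
have ev_inj phi : (forall d, ev d phi = 0) -> phi = 0 by apply: class_eval_inj.
have diag d : ev d (class_sum xi_prim d) <> 0 by apply: class_sum_diag.
have off d e : d != e -> ev e (class_sum xi_prim d) = 0 by apply: class_sum_off.
pose below (d : Cl G) := {subset (branch ev dom d : pred (Rbar G xi)) <=
  (P : pred (Rbar G xi))}.
have nonzeroQ : ~ ((Q : pred (Zxi xi)) =i pred1 0) ->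
    exists2 x, x <> 0 & x \in (Q : pred (Zxi xi)).
  move=> Q0; apply: contrapT => h; apply: Q0 => x; rewrite !inE.
  apply/idP/eqP => [xQ|->]; last by rewrite idealr0.
  by apply: contrapT => x0; apply: h; exists x.
have sing_two : singular_point P -> in_two_components P.
  move=> singP; apply: contrapT => /in_two_components_classP one.
  have sep d : d != c -> ~ below d by move=> dc dP; apply: one; exists d.
  apply: singP; have [Q0|/nonzeroQ[x x0 xQ]] := pselect ((Q : pred (Zxi xi)) =i pred1 0).
    exact: (regular_generic_point ev_inj Q0 sep).
  have [q q_pr qQ] := spec_nonzero_prime x0 xQ.
  have [pi [pi0 piQ pi_gen _]] := zxi_dvr xi_prim q_pr qQ.
  exact: (regular_closed_point evK ev_inj
    (@zxi_nonzero_prime_max _ _ xi_prim) pi0 piQ pi_gen).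
have two_cong : in_two_components P -> ~ ((Q : pred (Zxi xi)) =i pred1 0) /\
    exists2 d : Cl G, d != c & reg_class p c = reg_class p d.
  case/in_two_components_classP=> d dc dP.
  have Q0 : ~ ((Q : pred (Zxi xi)) =i pred1 0).
    move=> Q0; move/eqP: dc; apply.
    apply: (branch_incomparable (domO := dom) diag off).
    by move=> a /dP; rewrite mem_point Q0 mem_branch.
  split=> //; exists d => //; have [x x0 xQ] := nonzeroQ Q0.
  have [p_pr pQ] := has_char_prime charQ x0 xQ.
  apply/(class_cong_iff xi_prim _ _ p_pr pQ).
  exact/(branch_sub_point dom evK).
split.
  tfae=> // -[/nonzeroQ[x x0 xQ] [d dc cdE]].
  have [p_pr pQ] := has_char_prime charQ x0 xQ.
  have [pi [pi0 piQ pi_gen val_fin]] := zxi_dvr xi_prim p_pr pQ.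
  apply: (singular_crossing evK ev_inj diag off
    (@zxi_nonzero_prime_max _ _ xi_prim) pi0 piQ pi_gen val_fin dc).
  by apply/(branch_sub_point dom evK)/(class_cong_iff xi_prim _ _ p_pr pQ).
move=> p'G /sing_two/two_cong[_ [d /eqP dc cdE]].
have regE (e : Cl G) : reg_class p e = sval e.
  have [Gx eE] := Cl_repr e; rewrite reg_class_repr constt_p_elt -?eE //.
  rewrite /p_elt; apply: pnat_dvd (order_dvdG Gx) _.
  apply/pnatP => // q q_pr qG; rewrite !inE.
  by apply: contraNneq p'G => <-.
by apply/dc/val_inj; move: cdE; rewrite !regE.
Qed.
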